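(* Let $(M,g_{ab},u,Y_{ab},\xi^a[Y],\lambda)$ be an Einstein CKY--RS structure with $M$ connected of dimension $n\ge3$, let $\phi=e^{-u}$, and suppose $d\phi\not\equiv0$. Set $\alpha=c-\lambda$, where $c=\lambda-\xi(u)$ is the (constant) Einstein constant of $\tilde g=e^{2u}g$, so that $\mathcal{L}_\xi\phi=\alpha\phi$. Then either $\mathcal{L}_\xi\phi=0$ or $c=0$.
   Context: Conformal Killing--Yano (CKY) 2-form on an $n$-dimensional pseudo-Riemannian manifold: a smooth 2-form $Y_{ab}$ with $\nabla_cY_{ab}=g_{ca}\xi_b-g_{cb}\xi_a+z_{abc}$, where $z_{abc}$ is totally antisymmetric and $\xi_a=\frac{1}{n-1}\nabla^bY_{ba}$; $\xi^a=\xi^a[Y]$ is its associated vector field. CKY--RS structure $(M,g_{ab},u,Y_{ab},\xi^a[Y],\lambda)$: $u\in C^\infty(M)$, $\lambda\in\mathbb{R}$, $Y$ is a CKY 2-form of $g$, and $\tilde g_{ab}=e^{2u}g_{ab}$ satisfies $\tilde R_{ab}+\frac12\mathcal{L}_{\xi}\tilde g_{ab}=\lambda\tilde g_{ab}$ with $\xi=\xi[Y]$, $\tilde R_{ab}$ being the Ricci tensor of $\tilde g$. It is an Einstein CKY--RS structure if the background $g$ is Einstein, $R_{ab}=\Lambda g_{ab}$ with $\Lambda$ constant. On an Einstein background $\xi$ is a Killing field of $g$ and $\tilde R_{ab}=c\,\tilde g_{ab}$ with $c=\lambda-\xi(u)$ constant. *)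

(* Defs.v *)
(* R^n is represented by row vectors, over an arbitrary R : realType. *)
From HB Require Import structures.
From mathcomp Require Import all_boot all_order all_algebra.
From mathcomp Require Import all_classical all_reals all_analysis.
Set Implicit Arguments.
Unset Strict Implicit.
Unset Printing Implicit Defensive.
Import Order.TTheory GRing.Theory Num.Theory.
Import numFieldNormedType.Exports.
Local Open Scope classical_set_scope.
Local Open Scope ring_scope.

Section Calculus.
Context {R : realType} {n : nat}.
Implicit Types (U : set 'rV[R]_n) (f : 'rV[R]_n -> R) (x : 'rV[R]_n).

Definition pd (i : 'I_n) f : 'rV[R]_n -> R := 'D_(delta_mx 0 i) f.

(* [U] is meant to be open, so that continuity and partial derivatives at
   points of [U] do not depend on the values of [f] outside [U]. *)
Fixpoint Ck (k : nat) U f : Prop :=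
  (forall x, U x -> {for x, continuous f}) /\
  if k is k'.+1 then
    forall i, (forall x, U x -> derivable f x (delta_mx 0 i)) /\ Ck k' U (pd i f)
  else True.

Definition smooth_on U f := forall k, Ck k U f.

End Calculus.

(* A smooth manifold without boundary of dimension [n], given by an atlas
   (not necessarily maximal). The chart [a] is the homeomorphism [coord a] from
   the open set [chart_dom a] onto an open subset of R^n, with inverse
   [param a]; both are total functions, only meaningful on these sets. *)
Record manifold (R : realType) (n : nat) := Manifold {
  points :> topologicalType ;
  points_hausdorff : hausdorff_space points ;
  points_second_countable : @second_countable points ;
  chart : Type ;
  chart_dom : chart -> set points ;
  coord : chart -> points -> 'rV[R]_n ;
  param : chart -> 'rV[R]_n -> points ;
  chart_dom_open : forall a, open (chart_dom a) ;
  chart_im_open : forall a, open (coord a @` chart_dom a) ;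
  coordK : forall a p, chart_dom a p -> param a (coord a p) = p ;
  coord_continuous : forall a p, chart_dom a p -> {for p, continuous (coord a)} ;
  param_continuous : forall a x,
    (coord a @` chart_dom a) x -> {for x, continuous (param a)} ;
  chart_cover : forall p, exists a, chart_dom a p ;
  transition_smooth : forall a b (j : 'I_n),
    smooth_on (coord a @` (chart_dom a `&` chart_dom b))
              (fun x => coord b (param a x) 0 j)
}.

Section Fields.
Context {R : realType} {n : nat} (M : manifold R n).
Implicit Types (a b : chart M) (x : 'rV[R]_n).

Definition chart_im a : set 'rV[R]_n := coord a @` chart_dom a.

Definition overlap a b : set 'rV[R]_n := coord a @` (chart_dom a `&` chart_dom b).

Definition transition a b x : 'rV[R]_n := coord b (param a x).

(* [jacobian a b x i j] is the derivative of the [j]-th coordinate of the chart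
   [b] with respect to the [i]-th coordinate of the chart [a]. *)
Definition jacobian a b x : 'M[R]_n :=
  \matrix_(i, j) pd i (fun z => transition a b z 0 j) x.

Definition smooth_function (f : M -> R) :=
  forall a, smooth_on (chart_im a) (f \o param a).

(* Tensor fields are given classically: their components in every chart, as
   functions of the coordinates of that chart, subject to the transformation
   law. *)
Record vector_field := VectorField {
  vcomp :> chart M -> 'rV[R]_n -> 'rV[R]_n ;
  vcomp_smooth : forall a i, smooth_on (chart_im a) (fun x => vcomp a x 0 i) ;
  vcomp_law : forall a b x, overlap a b x ->
    vcomp b (transition a b x) = vcomp a x *m jacobian a b x
}.

(* Covariant 2-tensor fields. *)
Record tensor2 := Tensor2 {
  tcomp :> chart M -> 'rV[R]_n -> 'M[R]_n ;
  tcomp_smooth : forall a i j, smooth_on (chart_im a) (fun x => tcomp a x i j) ;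
  tcomp_law : forall a b x, overlap a b x ->
    tcomp a x =
      jacobian a b x *m tcomp b (transition a b x) *m (jacobian a b x)^T
}.

(* On a connected manifold the signature is then automatically constant. *)
Definition pseudo_riemannian (g : tensor2) := forall a x, chart_im a x ->
  (g a x)^T = g a x /\ g a x \in unitmx.

Definition two_form (Y : tensor2) := forall a x, chart_im a x ->
  (Y a x)^T = - Y a x.

End Fields.

(* Tensor calculus for the components in a single chart: [h] stands for the
   components of a metric, [T] and [Y] for those of covariant 2-tensors, and
   [v] for those of a vector field. *)
Section ChartCalculus.
Context {R : realType} {n : nat}.
Implicit Types (h T Y : 'rV[R]_n -> 'M[R]_n) (v : 'rV[R]_n -> 'rV[R]_n).
Implicit Types (x : 'rV[R]_n) (i j k a b c : 'I_n).

Definition inv_metric h x : 'M[R]_n := invmx (h x).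

(* Levi-Civita connection: [christoffel h k i j] has upper index [k]. *)
Definition christoffel h k i j x : R :=
  2^-1 * \sum_l inv_metric h x k l *
    (pd i (fun z => h z j l) x + pd j (fun z => h z i l) x
     - pd l (fun z => h z i j) x).

(* R_ij = d_k G^k_ij - d_j G^k_ik + G^k_kl G^l_ij - G^k_jl G^l_ik: the sign
   convention for which round spheres have positive Ricci tensor. *)
Definition ricci h x : 'M[R]_n := \matrix_(i, j)
  (\sum_k (pd k (christoffel h k i j) x - pd j (christoffel h k i k) x)
   + \sum_k \sum_l (christoffel h k k l x * christoffel h l i j x
                    - christoffel h k j l x * christoffel h l i k x)).

(* [nabla h T c a b] is the component nabla_c T_ab. *)
Definition nabla h T c a b x : R :=
  pd c (fun z => T z a b) x
  - \sum_k christoffel h k c a x * T x k b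
  - \sum_k christoffel h k c b x * T x a k.

(* xi_a = 1/(n-1) nabla^b Y_ba. *)
Definition assoc_covector h Y x : 'rV[R]_n := \row_a
  ((n%:R - 1)^-1 * \sum_b \sum_c inv_metric h x b c * nabla h Y c b a x).

(* xi^a = g^ab xi_b. *)
Definition assoc_vector h Y x : 'rV[R]_n := \row_a
  \sum_b inv_metric h x a b * assoc_covector h Y x 0 b.

Definition totally_antisymmetric (z : 'I_n -> 'I_n -> 'I_n -> R) :=
  forall a b c, z b a c = - z a b c /\ z a c b = - z a b c.

(* [z] is determined by the other terms of the equation, hence requiring it to
   exist pointwise already makes it a smooth 3-form. *)
Definition CKY_equation h Y x :=
  exists2 z, totally_antisymmetric z & forall a b c,
    nabla h Y c a b x =
      h x c a * assoc_covector h Y x 0 b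
      - h x c b * assoc_covector h Y x 0 a + z a b c.

Definition lie_scalar v (f : 'rV[R]_n -> R) x : R :=
  \sum_c v x 0 c * pd c f x.

Definition lie_tensor2 v T x : 'M[R]_n := \matrix_(a, b)
  \sum_c (v x 0 c * pd c (fun z => T z a b) x
          + T x c b * pd a (fun z => v z 0 c) x
          + T x a c * pd b (fun z => v z 0 c) x).

End ChartCalculus.

Section Structures.
Context {R : realType} {n : nat} (M : manifold R n).
Implicit Types (g Y : tensor2 M) (u f : M -> R) (xi : vector_field M).

Definition CKY_two_form g Y := two_form Y /\
  forall a x, chart_im a x -> CKY_equation (g a) (Y a) x.

Definition is_assoc_vector_field g Y xi := forall a x, chart_im a x ->
  xi a x = assoc_vector (g a) (Y a) x.

Definition einstein_metric g := exists Lambda : R,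
  forall a x, chart_im a x -> ricci (g a) x = Lambda *: g a x.

(* Components in the chart [a] of the rescaled metric e^(2u) g. *)
Definition conformal_metric u g (a : chart M) (x : 'rV[R]_n) : 'M[R]_n :=
  expR (2 * u (param a x)) *: g a x.

(* The function L_xi f = xi(f), read in the chart [a]. *)
Definition lie_function xi f (a : chart M) : 'rV[R]_n -> R :=
  lie_scalar (xi a) (f \o param a).

Definition nonzero_differential f := exists a x i,
  chart_im a x /\ pd i (f \o param a) x != 0.

Record CKY_RS_structure g u Y xi (lambda : R) : Prop := CKYRSStructure {
  CKY_RS_metric : pseudo_riemannian g ;
  CKY_RS_smooth : smooth_function u ;
  CKY_RS_CKY : CKY_two_form g Y ;
  CKY_RS_assoc : is_assoc_vector_field g Y xi ;
  CKY_RS_soliton : forall a x, chart_im a x ->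
    ricci (conformal_metric u g a) x
      + 2^-1 *: lie_tensor2 (xi a) (conformal_metric u g a) x
    = lambda *: conformal_metric u g a x
}.

Definition einstein_CKY_RS_structure g u Y xi lambda :=
  CKY_RS_structure g u Y xi lambda /\ einstein_metric g.

End Structures.

(* Main.v *)
Require Import Defs.
From HB Require Import structures.
From mathcomp Require Import all_boot all_order all_algebra.
From mathcomp Require Import all_classical all_reals all_analysis.
From mathcomp Require Import ring lra.
Set Implicit Arguments.
Unset Strict Implicit.
Unset Printing Implicit Defensive.
Import Order.TTheory GRing.Theory Num.Theory.
Import numFieldNormedType.Exports.
Local Open Scope classical_set_scope.
Local Open Scope ring_scope.

(* On an Einstein background the trace of the integrability condition of the
   CKY equation shows that xi is a Killing field of g. Hence
   L_xi h = 2 s h for h = e^(2u) g and s = xi(u), so the soliton equation reads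
   Ric(h) = (lambda - s) h and s is constant by Schur's lemma: xi is homothetic
   for the Einstein metric h. The Ricci identity then gives
   div omega = c xi for the antisymmetric part omega of the h-covariant
   derivative of xi, and, the double divergence of a bivector being zero,
   0 = c div xi = n c s; as s = lambda - c = - alpha, this is the claim.
   All tensor identities used are polynomial in the partial derivatives, hence
   hold over any commutative ring with commuting derivations, such as the ring
   of smooth functions on the image of a chart. *)

(** * Connections over a differential ring *)

(** Two constraints shape the algebra. The ring of smooth functions on an open set has zero divisors
    and is not closed under division, so nothing is divided by: apart from [half] there is only the
    cancellation of positive integers ([char0]), the inverse metric is a given matrix [N], and
    e^(2u) is an element [e] with a given inverse and a prescribed derivative. For the same reason n
    c s = 0 splits into two cases only after evaluation at a point, where c and s are real numbers.

    The bound n >= 3 enters through n - 2, which is [m.+1] for n = [m.+3]. The traced CKY identity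
    has the form (n - 2) nabla_d xi_b + (div xi) g_db + antisymmetric terms = 0. Its symmetric part,
    traced once more, gives 4 (n - 1) div xi = 0; putting div xi = 0 back leaves n - 2 times the
    Killing equation. Likewise the doubly contracted second Bianchi identity for Ric = f g reads (n
    - 2) D_i f = 0. *)

Section DifferentialRing.
Context {A : comPzRingType} {n : nat} (D : 'I_n -> A -> A).
Hypothesis DD : forall i x y, D i (x + y) = D i x + D i y.
Hypothesis DM : forall i x y, D i (x * y) = D i x * y + x * D i y.
Hypothesis DC : forall i j x, D i (D j x) = D j (D i x).
Context (half : A).
Hypothesis half2 : half + half = 1.

Lemma der0 i : D i 0 = 0.
Proof. by apply: (addrI (D i 0)); rewrite -DD !addr0. Qed.

Lemma derN i (x : A) : D i (- x) = - D i x.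
Proof. by apply: (addrI (D i x)); rewrite -DD !subrr der0. Qed.

Lemma der1 i : D i 1 = 0.
Proof.
have := DM i 1 1; rewrite !mulr1 mul1r => /(congr1 (fun z => z - D i 1)).
by rewrite subrr addrK.
Qed.

Lemma der_sum i (I : Type) (r : seq I) (P : pred I) (f : I -> A) :
  D i (\sum_(k <- r | P k) f k) = \sum_(k <- r | P k) D i (f k).
Proof. by elim/big_rec2: _ => [|k y z _ <-]; rewrite ?der0 ?DD. Qed.

Lemma half_eq0 (x : A) : x + x = 0 -> x = 0.
Proof. by move=> xx; rewrite -[x]mul1r -half2 mulrDl -mulrDr xx mulr0. Qed.

Lemma der_nat i (m : nat) : D i m%:R = 0.
Proof. by elim: m => [|m IH]; rewrite ?der0 // -natr1 DD IH der1 addr0. Qed.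

Definition dermx p q i (X : 'M[A]_(p, q)) := map_mx (D i) X.

Lemma dermxD p q i (X Z : 'M[A]_(p, q)) : dermx i (X + Z) = dermx i X + dermx i Z.
Proof. by apply/matrixP => a b; rewrite !mxE DD. Qed.

Lemma dermxN p q i (X : 'M[A]_(p, q)) : dermx i (- X) = - dermx i X.
Proof. by apply/matrixP => a b; rewrite !mxE derN. Qed.

Lemma dermxM p q r i (X : 'M[A]_(p, q)) (Z : 'M[A]_(q, r)) :
  dermx i (X *m Z) = dermx i X *m Z + X *m dermx i Z.
Proof.
apply/matrixP => a b; rewrite !mxE der_sum -big_split; apply: eq_bigr => k _.
by rewrite !mxE DM.
Qed.

Lemma dermxT p q i (X : 'M[A]_(p, q)) : dermx i X^T = (dermx i X)^T.
Proof. by apply/matrixP => a b; rewrite !mxE. Qed.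

Lemma dermxC p q i j (X : 'M[A]_(p, q)) : dermx i (dermx j X) = dermx j (dermx i X).
Proof. by apply/matrixP => a b; rewrite !mxE DC. Qed.

Lemma dermx_cst i (c : A) p : (D i c = 0) -> dermx i (c%:M : 'M[A]_p) = 0.
Proof.
move=> Dc; apply/matrixP => a b; rewrite !mxE.
by case: eqP => _; rewrite ?mulr1n ?mulr0n ?Dc ?der0.
Qed.

Lemma mxDE p q (X Z : 'M[A]_(p, q)) a b : (X + Z) a b = X a b + Z a b.
Proof. by rewrite mxE. Qed.

Lemma mxNE p q (X : 'M[A]_(p, q)) a b : (- X) a b = - X a b.
Proof. by rewrite mxE. Qed.

Lemma trmxD p q (X Z : 'M[A]_(p, q)) : (X + Z)^T = X^T + Z^T.
Proof. by apply/matrixP => a b; rewrite !mxE. Qed.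

Lemma trmxN p q (X : 'M[A]_(p, q)) : (- X)^T = - X^T.
Proof. by apply/matrixP => a b; rewrite !mxE. Qed.

Lemma mxZE p q x (X : 'M[A]_(p, q)) a b : (x *: X) a b = x * X a b.
Proof. by rewrite mxE. Qed.

Definition mxlinE := (mxDE, mxNE).

(* [N] is the inverse metric and [G i] the matrix of nabla_i in the coordinate
   frame: [G i j k] is Gamma^k_ij. Components of vectors are rows, on which
   endomorphisms act from the right. *)
Section Connection.
Context (g N : 'M[A]_n) (G : 'I_n -> 'M[A]_n).
Hypothesis gsym : g^T = g.
Hypothesis gN : g *m N = 1%:M.
Hypothesis Gtors : forall i j k, G i j k = G j i k.
Hypothesis Gcompat : forall i, dermx i g = G i *m g + g *m (G i)^T.

(** The commutator of nabla_i and nabla_j on rows, v being sent to [v *m curv i j]. The products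
    stand in this order because endomorphisms act from the right. *)
Definition curv i j := dermx i (G j) - dermx j (G i) + G j *m G i - G i *m G j.

Lemma curvC i j : curv j i = - curv i j.
Proof.
by rewrite /curv; apply/matrixP => a b; rewrite !mxlinE; ring.
Qed.

Lemma Nsym : N^T = N.
Proof.
by rewrite -[LHS]mulmx1 -gN mulmxA -{1}gsym -trmx_mul gN trmx1 mul1mx.
Qed.

(** Differentiating [Gcompat] once more and using that D_i and D_j commute on g leaves exactly this
    identity. *)
Lemma curv_skew i j : curv i j *m g = - (g *m (curv i j)^T).
Proof.
have DDg a b : dermx a (dermx b g) =
    dermx a (G b) *m g + G b *m G a *m g + G b *m g *m (G a)^T
    + G a *m g *m (G b)^T + g *m (G a)^T *m (G b)^T + g *m (dermx a (G b))^T.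
  rewrite Gcompat dermxD !dermxM dermxT Gcompat !mulmxDl !mulmxDr !mulmxA.
  by rewrite !addrA.
have := DDg i j; rewrite dermxC DDg /curv => /matrixP E; apply/matrixP => a b.
move: (E a b); rewrite !(trmxD, trmxN) !trmx_mul.
rewrite !(mulmxDl, mulmxDr, mulNmx, mulmxN, mulmxA) !mxlinE => {}E.
apply/eqP; rewrite -subr_eq0; move/eqP: E.
by rewrite -subr_eq0 -oppr_eq0 => /eqP <-; apply/eqP; ring.
Qed.

Lemma inv_curv_skew i j : N *m curv i j = - ((curv i j)^T *m N).
Proof.
rewrite -[LHS]mulmx1 -gN mulmxA -[N *m _ *m g]mulmxA curv_skew.
by rewrite mulmxN mulNmx !mulmxA (mulmx1C gN) mul1mx.
Qed.

(** Torsion-freeness makes the quadratic part [S] symmetric in its first two indices; the cyclic sum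
    then cancels term by term. *)
Lemma bianchi1 i j k l : curv i j k l + curv j k i l + curv k i j l = 0.
Proof.
pose S a b c := \sum_m G a b m * G c m l.
have SC a b c : S a b c = S b a c by apply: eq_bigr => m _; rewrite Gtors.
have cE a b c : curv a b c l =
    D a (G b c l) - D b (G a c l) + S b c a - S a c b.
  by rewrite /curv !mxlinE !mxE.
rewrite !cE (Gtors j k) (Gtors k i) (Gtors i j).
by rewrite (SC j k) (SC i k) (SC j i); ring.
Qed.

Definition riem i j k l := (curv i j *m g) k l.

Lemma riemC i j k l : riem j i k l = - riem i j k l.
Proof. by rewrite /riem curvC mulNmx mxNE. Qed.

Lemma riem_skew i j k l : riem i j l k = - riem i j k l.
Proof.
rewrite /riem [in LHS]curv_skew mxNE; congr (- _).
by rewrite -{1}gsym -trmx_mul mxE.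
Qed.

Lemma riem_bianchi i j k l : riem i j k l + riem j k i l + riem k i j l = 0.
Proof.
rewrite /riem !mxE -!big_split big1 // => m _ /=.
by rewrite -!mulrDl bianchi1 mul0r.
Qed.

Lemma riem_pair i j k l : riem i j k l = riem k l i j.
Proof.
apply/eqP; rewrite -subr_eq0; apply/eqP; apply: half_eq0.
(* A signed sum of four first Bianchi identities, one for each choice of the last index. By the two
   skew symmetries all terms cancel except twice the difference sought. *)
have <- : riem i j k l + riem j k i l + riem k i j l
  + (riem j k l i + riem k l j i + riem l j k i)
  - (riem k l i j + riem l i k j + riem i k l j)
  - (riem l i j k + riem i j l k + riem j l i k)
  = riem i j k l - riem k l i j + (riem i j k l - riem k l i j).
  rewrite (riemC i k j) (riem_skew j k i l) (riem_skew k l i j) (riemC j l).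
  rewrite (riem_skew i k j l) (riem_skew i j k l) (riem_skew j l i k).
  by rewrite (riem_skew l i j k); ring.
by rewrite !riem_bianchi; ring.
Qed.

Definition ric : 'M[A]_n := \matrix_(i, j) \sum_k curv k j i k.

Lemma riem_raise i j k l : curv i j k l = \sum_m riem i j k m * N m l.
Proof.
transitivity ((curv i j *m g *m N) k l); last by rewrite mxE.
by rewrite -mulmxA gN mulmx1.
Qed.

Definition trace_g (X : 'I_n -> 'I_n -> A) := \sum_i \sum_j N i j * X i j.

Lemma eq_trace_g X Z : (forall i j, X i j = Z i j) -> trace_g X = trace_g Z.
Proof. by move=> XZ; apply: eq_bigr => i _; apply: eq_bigr => j _; rewrite XZ. Qed.

Lemma trace_gD X Z : trace_g (fun i j => X i j + Z i j) = trace_g X + trace_g Z.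
Proof.
rewrite /trace_g -big_split; apply: eq_bigr => i _.
by rewrite -big_split; apply: eq_bigr => j _; rewrite mulrDr.
Qed.

Lemma trace_gN X : trace_g (fun i j => - X i j) = - trace_g X.
Proof.
rewrite /trace_g -sumrN; apply: eq_bigr => i _.
by rewrite -sumrN; apply: eq_bigr => j _; rewrite mulrN.
Qed.

Lemma trace_gZ x X : trace_g (fun i j => x * X i j) = x * trace_g X.
Proof.
rewrite /trace_g mulr_sumr; apply: eq_bigr => i _.
by rewrite mulr_sumr; apply: eq_bigr => j _; rewrite mulrCA.
Qed.

Lemma sum_antisym (X : 'I_n -> 'I_n -> A) :
  (forall i j, X j i = - X i j) -> \sum_i \sum_j X i j = 0.
Proof.
move=> Xa; apply: half_eq0; rewrite {2}exchange_big -big_split big1 // => i _.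
by rewrite -big_split big1 // => j _; rewrite /= (Xa i j) subrr.
Qed.

Lemma Nentry i j : N j i = N i j.
Proof. by rewrite -{1}Nsym mxE. Qed.

Lemma gentry i j : g j i = g i j.
Proof. by rewrite -{1}gsym mxE. Qed.

Lemma trace_gT X : trace_g (fun i j => X j i) = trace_g X.
Proof.
rewrite /trace_g exchange_big; apply: eq_bigr => i _; apply: eq_bigr => j _.
by rewrite Nentry.
Qed.

Lemma trace_g_antisym X : (forall i j, X j i = - X i j) -> trace_g X = 0.
Proof.
by move=> Xa; apply: sum_antisym => i j; rewrite Nentry Xa mulrN.
Qed.

Lemma trace_g_gl k (f : 'I_n -> A) : trace_g (fun i j => g i k * f j) = f k.
Proof.
rewrite /trace_g exchange_big (bigD1 k) //= [X in _ + X]big1 ?addr0 => [|j jk].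
  transitivity ((N *m g) k k * f k); last by rewrite (mulmx1C gN) mxE eqxx mul1r.
  by rewrite mxE mulr_suml; apply: eq_bigr => i _; rewrite Nentry mulrA.
transitivity ((N *m g) j k * f j).
  by rewrite mxE mulr_suml; apply: eq_bigr => i _; rewrite Nentry mulrA.
by rewrite (mulmx1C gN) mxE (negPf jk) mul0r.
Qed.

Lemma trace_g_gr k (f : 'I_n -> A) : trace_g (fun i j => f i * g j k) = f k.
Proof. by rewrite -trace_gT -[RHS]trace_g_gl; apply: eq_trace_g => i j; rewrite mulrC. Qed.

Lemma trace_g_g : trace_g (fun i j => g i j) = n%:R.
Proof.
transitivity (\tr (N *m g)); last by rewrite (mulmx1C gN) mxtrace1.
rewrite /mxtrace; apply: eq_bigr => i _; rewrite mxE.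
by apply: eq_bigr => j _; rewrite gentry.
Qed.

(** The metric contracts an argument pair other than the one in [ric]; skewness of the curvature
    with a raised index moves the contraction to the right place. *)
Lemma ric_trace_g d e :
  trace_g (fun c a => curv d c a e) = \sum_a N e a * ric a d.
Proof.
transitivity (\sum_c (N *m curv d c) c e).
  by apply: eq_bigr => c _; rewrite mxE.
transitivity (\sum_c \sum_a N e a * curv c d a c).
  apply: eq_bigr => c _; rewrite inv_curv_skew mxNE mxE -sumrN.
  apply: eq_bigr => a _.
  by rewrite mxE (curvC c d) mxNE mulNr opprK mulrC Nentry.
rewrite exchange_big; apply: eq_bigr => a _; rewrite mxE mulr_sumr.
by apply: eq_bigr.
Qed.

Definition nabla_mx c (Y : 'M[A]_n) := dermx c Y - G c *m Y - Y *m (G c)^T.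

(** The index of the inner derivative is inert here: its correction term, [G d c e] times nabla_e Y,
    is left out. By torsion-freeness that term is symmetric in c and d, so the commutator is the one
    of true second covariant derivatives. *)
Lemma nabla_mx_comm c d Y a b :
  nabla_mx d (nabla_mx c Y) a b - nabla_mx c (nabla_mx d Y) a b =
  - (curv d c *m Y) a b - (Y *m (curv d c)^T) a b.
Proof.
rewrite /nabla_mx /curv.
rewrite !(trmxD, trmxN) !trmx_mul.
rewrite !(dermxD, dermxN, dermxM, dermxT).
rewrite !(mulmxDl, mulmxDr, mulNmx, mulmxN, mulmxA) (dermxC d c).
by rewrite !mxlinE; ring.
Qed.

Definition nabla_form (xi : 'I_n -> A) d b := D d (xi b) - \sum_e G d b e * xi e.

(** * CKY 2-forms on an Einstein background *)

Section Killing.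
Context (Y : 'M[A]_n) (xi : 'I_n -> A) (z : 'I_n -> 'I_n -> 'I_n -> A) (L : A).
Hypothesis Ya : Y^T = - Y.
Hypothesis za12 : forall a b c, z b a c = - z a b c.
Hypothesis za23 : forall a b c, z a c b = - z a b c.
Hypothesis cky : forall a b c,
  nabla_mx c Y a b = g c a * xi b - g c b * xi a + z a b c.
Hypothesis einstein : ric = L *: g.

Local Notation K := (nabla_form xi).

Let T d a b c := D d (z a b c) - \sum_e G d c e * z a b e
  - \sum_e G d a e * z e b c - \sum_e G d b e * z a e c.

(** The covariant derivative of the CKY equation. The terms containing [G d] come from the inert
    index c; they are symmetric in c and d and disappear from the commutator. *)
Let covcov d c a b : nabla_mx d (nabla_mx c Y) a b =
  (G d *m g) c a * xi b + g c a * K d b - (G d *m g) c b * xi a - g c b * K d a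
  + T d a b c + \sum_e G d c e * z a b e.
Proof.
have gd x y : D d (g x y) = (G d *m g) x y + \sum_e G d y e * g x e.
  have /matrixP/(_ x y) := Gcompat d; rewrite mxDE [in LHS]mxE => ->.
  congr (_ + _); rewrite mxE; apply: eq_bigr => e _.
  by rewrite [_^T _ _]mxE mulrC.
rewrite {1}/nabla_mx !mxlinE [dermx _ _ _ _]mxE cky !mxE !(DD, derN, DM) !gd.
have -> : \sum_j G d a j * nabla_mx c Y j b =
   (\sum_e G d a e * g c e) * xi b - (\sum_e G d a e * xi e) * g c b
   + \sum_e G d a e * z e b c.
  rewrite !mulr_suml -sumrB -big_split; apply: eq_bigr => e _ /=.
  by rewrite cky; ring.
have -> : \sum_j nabla_mx c Y a j * (G d)^T j b =
   (\sum_e G d b e * xi e) * g c a - (\sum_e G d b e * g c e) * xi a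
   + \sum_e G d b e * z a e c.
  rewrite !mulr_suml -sumrB -big_split; apply: eq_bigr => e _ /=.
  by rewrite cky [_^T _ _]mxE; ring.
by rewrite /nabla_form /T !mxE; ring.
Qed.

Let Tanti13 d a b c : T d c b a = - T d a b c.
Proof.
have z13 x y w : z w y x = - z x y w by rewrite za12 za23 za12 !opprK.
have S (f h1 h2 : 'I_n -> A) : (forall e, h1 e = - h2 e) ->
    \sum_e f e * h1 e = - (\sum_e f e * h2 e).
  by move=> h12; rewrite -sumrN; apply: eq_bigr => e _; rewrite h12 mulrN.
rewrite /T (z13 c b a) derN.
rewrite (S (G d a) _ _ (fun e => z13 e b c)) (S (G d c) _ _ (fun e => z13 a b e)).
by rewrite (S (G d b) _ _ (fun e => z13 a e c)); ring.
Qed.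

Let Tanti23 d a b c : T d a c b = - T d a b c.
Proof.
have S (f h1 h2 : 'I_n -> A) : (forall e, h1 e = - h2 e) ->
    \sum_e f e * h1 e = - (\sum_e f e * h2 e).
  by move=> h12; rewrite -sumrN; apply: eq_bigr => e _; rewrite h12 mulrN.
rewrite /T (za23 a b c) derN.
rewrite (S (G d b) _ _ (fun e => za23 a e c)) (S (G d c) _ _ (fun e => za23 a b e)).
by rewrite (S (G d a) _ _ (fun e => za23 e b c)); ring.
Qed.

Let P d b := trace_g (fun c a => (Y *m (curv d c)^T) a b).

Let PE d b : P d b = \sum_c \sum_f (N *m Y *m N) c f * riem d c b f.
Proof.
rewrite /P /trace_g; apply: eq_bigr => c _.
transitivity ((N *m (Y *m (curv d c)^T)) c b); first by rewrite mxE.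
rewrite mulmxA mxE.
under eq_bigr => e _ do rewrite [_^T _ _]mxE riem_raise mulr_sumr.
rewrite exchange_big; apply: eq_bigr => f _; rewrite [in RHS]mxE mulr_suml.
by apply: eq_bigr => e _; rewrite Nentry; ring.
Qed.

(** By [PE] this is Y^cf R_dcbf. Pair symmetry of the curvature turns the exchange of d and b into
    an exchange of the two indices of the raised Y. *)
Let Panti d b : P b d = - P d b.
Proof.
have Xa c f : (N *m Y *m N) f c = - (N *m Y *m N) c f.
  transitivity ((N *m Y *m N)^T c f); first by rewrite [RHS]mxE.
  by rewrite !trmx_mul Ya Nsym mulNmx mulmxN mulmxA mxNE.
rewrite !PE -sumrN exchange_big; apply: eq_bigr => c _.
rewrite -sumrN; apply: eq_bigr => f _.
by rewrite Xa riem_pair mulNr.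
Qed.

(** The divergence of [z], antisymmetric because [z] is. *)
Let Q d b := trace_g (fun c a => T c a b d).

Let Qanti d b : Q b d = - Q d b.
Proof. by rewrite /Q -trace_gN; apply: eq_trace_g => c a; rewrite Tanti23. Qed.

Let theta := trace_g (fun c a => K c a).

(** The Ricci identity for Y in the directions d, c, traced over c and a. The term nabla_d z_abc has
    no trace, and the Einstein condition turns one of the two curvature terms into [L * Y d b]. *)
Let contracted d b :
  n%:R * K d b - 2 * K d b + theta * g d b - Q d b + L * Y d b + P d b = 0.
Proof.
have E c a : g c a * K d b - g c b * K d a - g d a * K c b + K c a * g d b
   + T d a b c - T c a b d = - (curv d c *m Y) a b - (Y *m (curv d c)^T) a b.
  rewrite -nabla_mx_comm !covcov.
  have PC x : (G d *m g) c x = (G c *m g) d x.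
    by rewrite !mxE; apply: eq_bigr => e _; rewrite Gtors.
  have -> : \sum_e G d c e * z a b e = \sum_e G c d e * z a b e.
    by apply: eq_bigr => e _; rewrite Gtors.
  by rewrite !PC; ring.
have T0 : trace_g (fun c a => T d a b c) = 0.
  by apply: trace_g_antisym => c a; rewrite Tanti13.
have T1 : trace_g (fun c a => T c a b d) = Q d b by [].
move: E T0 T1; generalize T => T' E T0 T1.
have := eq_trace_g E.
rewrite !(trace_gD, trace_gN) trace_g_gl -/(P d b).
have -> : trace_g (fun c a => g c a * K d b) = n%:R * K d b.
  by rewrite -trace_g_g mulrC -trace_gZ; apply: eq_trace_g => c a; rewrite mulrC.
have -> : trace_g (fun c a => g d a * K c b) = K d b.
  by rewrite -[RHS](trace_g_gr d (fun c => K c b)); apply: eq_trace_g => c a;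
    rewrite gentry mulrC.
have -> : trace_g (fun c a => K c a * g d b) = theta * g d b.
  by rewrite mulrC -trace_gZ; apply: eq_trace_g => c a; rewrite mulrC.
rewrite T0 T1.
have -> : trace_g (fun c a => (curv d c *m Y) a b) = L * Y d b.
  transitivity (\sum_e trace_g (fun c a => curv d c a e) * Y e b).
    rewrite /trace_g; under [RHS]eq_bigr do rewrite mulr_suml.
    rewrite [RHS]exchange_big; apply: eq_bigr => c _.
    under [RHS]eq_bigr do rewrite mulr_suml.
    rewrite [RHS]exchange_big; apply: eq_bigr => a _.
    by rewrite mxE mulr_sumr; apply: eq_bigr => e _; rewrite mulrA.
  have ricN e : \sum_a N e a * ric a d = L * (e == d)%:R.
    transitivity ((N *m ric) e d); first by rewrite mxE.
    by rewrite einstein -scalemxAr (mulmx1C gN) !mxE.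
  under eq_bigr => e _ do rewrite ric_trace_g ricN.
  rewrite (bigD1 d) //= eqxx mulr1 big1 ?addr0 // => e /negPf ->.
  by rewrite mulr0 mul0r.
by move=> E1; rewrite -[RHS](subrr (- (L * Y d b) - P d b)) -{1}E1; ring.
Qed.

Lemma cky_einstein_killing m (n3 : n = m.+3)
    (char0 : forall m (x : A), m.+1%:R * x = 0 -> x = 0) d b : K d b + K b d = 0.
Proof.
have nR : n%:R = m.+1%:R + 2 :> A by rewrite n3 -natrD addn2.
have sumK d' b' : m.+1%:R * (K d' b' + K b' d') + 2 * theta * g d' b' = 0.
  have YC : Y b' d' = - Y d' b'.
    by have /matrixP/(_ d' b') := Ya; rewrite mxE mxNE.
  transitivity (n%:R * K d' b' - 2 * K d' b' + theta * g d' b' - Q d' b'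
    + L * Y d' b' + P d' b' + (n%:R * K b' d' - 2 * K b' d' + theta * g b' d'
    - Q b' d' + L * Y b' d' + P b' d')); last by rewrite !contracted addr0.
  by rewrite YC Qanti Panti (gentry d' b') nR; ring.
have theta0 : theta = 0.
  (* The trace of [sumK] has coefficient 2 (n - 2) + 2 n = 4 m + 8. *)
  apply: (char0 (4 * m + 7)%N).
  have <- : trace_g (fun _ _ => 0) = 0.
    by rewrite trace_g_antisym // => *; rewrite oppr0.
  have KE : trace_g (fun i j => K i j + K j i) = theta + theta.
    by rewrite (trace_gD K (fun i j => K j i)) (trace_gT K).
  by rewrite -(eq_trace_g sumK) trace_gD !trace_gZ KE trace_g_g nR; ring.
by apply: (char0 m); have := sumK d b; rewrite theta0 mulr0 mul0r addr0.
Qed.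

End Killing.

(** * The second Bianchi identity and Schur's lemma *)

Lemma curv_bianchi2 i j k :
  (dermx i (curv j k) + curv j k *m G i - G i *m curv j k)
  + (dermx j (curv k i) + curv k i *m G j - G j *m curv k i)
  + (dermx k (curv i j) + curv i j *m G k - G k *m curv i j) = 0.
Proof.
rewrite /curv; apply/matrixP => a b.
rewrite !(dermxD, dermxN, dermxM) (dermxC i j) (dermxC i k) (dermxC j k).
rewrite !(mulmxDl, mulmxDr, mulNmx, mulmxN, mulmxA).
by rewrite !mxlinE [RHS]mxE; ring.
Qed.

Lemma derN_inv i : dermx i N = - (N *m G i) - (G i)^T *m N.
Proof.
have : dermx i (g *m N) = 0 by rewrite gN (dermx_cst _ (der1 i)).
rewrite dermxM Gcompat => /(congr1 (mulmx N)).
rewrite mulmx0 mulmxDr mulmxDl mulmxDr !mulmxA (mulmx1C gN) !mul1mx.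
rewrite -[N *m G i *m g *m N]mulmxA gN mulmx1 => /eqP.
by rewrite addrC addr_eq0 opprD => /eqP.
Qed.

(** The first three terms differentiate [curv j k] as an endomorphism; for these alone the cyclic
    identity is the Jacobi identity of the nabla_i. The sum corrects the form indices j and k, and
    its cyclic sum vanishes by torsion-freeness. *)
Definition nabla_curv i j k := dermx i (curv j k) + curv j k *m G i - G i *m curv j k
  - \sum_e (G i j e *: curv e k + G i k e *: curv j e).

Lemma nabla_curvC i j k : nabla_curv i k j = - nabla_curv i j k.
Proof.
rewrite /nabla_curv (curvC j k) dermxN mulNmx mulmxN.
have -> : \sum_e (G i k e *: curv e j + G i j e *: curv k e)
        = - \sum_e (G i j e *: curv e k + G i k e *: curv j e).
  rewrite -sumrN; apply: eq_bigr => e _.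
  by rewrite (curvC j e) (curvC e k) !scalerN opprD addrC.
by rewrite !opprD !opprK.
Qed.

Lemma nabla_curv_bianchi i j k : nabla_curv i j k + nabla_curv j k i + nabla_curv k i j = 0.
Proof.
rewrite -[RHS](curv_bianchi2 i j k) /nabla_curv.
have E : \sum_e (G i j e *: curv e k + G i k e *: curv j e)
  + \sum_e (G j k e *: curv e i + G j i e *: curv k e)
  + \sum_e (G k i e *: curv e j + G k j e *: curv i e) = 0.
  rewrite -!big_split big1 // => e _ /=.
  rewrite (Gtors j i) (Gtors k i) (Gtors k j).
  rewrite (curvC e k) (curvC e i) (curvC e j) !scalerN.
  by apply/matrixP => a b; rewrite !mxlinE [RHS]mxE; ring.
have H (a b c s t u : 'M[A]_n) : s + t + u = 0 ->
    (a - s) + (b - t) + (c - u) = a + b + c.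
  by move=> stu; rewrite (addrACA a) -opprD (addrACA (a + b)) -opprD stu subr0.
exact: H.
Qed.

(** Membership in so(g), written with an index raised: [N *m X] is an antisymmetric matrix. *)
Definition inv_skew (X : 'M[A]_n) := N *m X = - (X^T *m N).

Lemma inv_skewD X Z : inv_skew X -> inv_skew Z -> inv_skew (X + Z).
Proof. by rewrite /inv_skew mulmxDr trmxD mulmxDl opprD => -> ->. Qed.

Lemma inv_skewZ x X : inv_skew X -> inv_skew (x *: X).
Proof.
rewrite /inv_skew -scalemxAr => ->; rewrite scalerN scalemxAl; congr (- (_ *m _)).
by apply/matrixP => a b; rewrite !mxE.
Qed.

Lemma inv_skew_sum (X : 'I_n -> 'M[A]_n) :
  (forall e, inv_skew (X e)) -> inv_skew (\sum_e X e).
Proof.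
move=> Xs; apply: (@big_ind _ inv_skew) => //; last exact: inv_skewD.
by rewrite /inv_skew mulmx0 trmx0 mul0mx oppr0.
Qed.

Lemma nabla_curv_skew i j k : inv_skew (nabla_curv i j k).
Proof.
have E : N *m (dermx i (curv j k) + curv j k *m G i - G i *m curv j k)
    = - ((dermx i (curv j k) + curv j k *m G i - G i *m curv j k)^T *m N).
  have := congr1 (dermx i) (inv_curv_skew j k).
  move: (inv_curv_skew j k); generalize (curv j k) => F NF.
  have GN : (G i)^T *m N *m F = - ((G i)^T *m F^T *m N).
    by rewrite -mulmxA NF mulmxN mulmxA.
  have NG : N *m F *m G i = - (F^T *m N *m G i) by rewrite NF mulNmx.
  move=> /matrixP E; apply/matrixP => a b; move: (E a b).
  rewrite dermxN !dermxM dermxT derN_inv !(trmxD, trmxN) !trmx_mul.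
  rewrite !(mulmxDl, mulmxDr, mulNmx, mulmxN, mulmxA) GN NG.
  rewrite !mxlinE => /eqP; rewrite -subr_eq0 => /eqP {}E.
  by apply/eqP; rewrite -subr_eq0 -E; apply/eqP; ring.
apply: inv_skewD; first exact: E.
rewrite -scaleN1r; apply: inv_skewZ; apply: inv_skew_sum => e.
by apply: inv_skewD; apply: inv_skewZ; apply: inv_curv_skew.
Qed.

Lemma nabla_curvE i j k l m : nabla_curv i j k l m = D i (curv j k l m) +
  \sum_e (curv j k l e * G i e m - G i l e * curv j k e m
          - G i j e * curv e k l m - G i k e * curv j e l m).
Proof.
rewrite /nabla_curv; generalize curv => F.
rewrite !mxlinE summxE ![(_ *m _) _ _]mxE [dermx _ _ _ _]mxE -!addrA.
congr (_ + _); rewrite -!sumrN -!big_split; apply: eq_bigr => e _ /=.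
by rewrite mxDE !mxZE; ring.
Qed.

(** Contraction commutes with nabla, so the sum is nabla_i of the Ricci tensor f g; as nabla g = 0,
    only the derivative of f survives. *)
Lemma nabla_curv_contr f i k l : ric = f *: g ->
  \sum_j nabla_curv i j k l j = D i f * g l k.
Proof.
move=> einstein.
have ricE a b : \sum_j curv j b a j = f * g a b.
  by have /matrixP/(_ a b) := einstein; rewrite !mxE.
under eq_bigr do rewrite nabla_curvE.
move: ricE; generalize curv => F ricE; rewrite big_split /= -der_sum ricE DM.
have -> : D i (g l k) = \sum_e G i l e * g e k + \sum_e G i k e * g l e.
  have /matrixP/(_ l k) := Gcompat i; rewrite mxDE [in LHS]mxE => ->.
  rewrite !mxE; congr (_ + _); apply: eq_bigr => e _.
  by rewrite [_^T _ _]mxE mulrC.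
have -> : \sum_j \sum_e (F j k l e * G i e j - G i l e * F j k e j
      - G i j e * F e k l j - G i k e * F j e l j)
    = - (f * \sum_e G i l e * g e k) - f * \sum_e G i k e * g l e.
  transitivity (\sum_j \sum_e F j k l e * G i e j
      - \sum_j \sum_e G i l e * F j k e j - \sum_j \sum_e G i j e * F e k l j
      - \sum_j \sum_e G i k e * F j e l j).
    by rewrite -!sumrB; apply: eq_bigr => j _; rewrite -!sumrB.
  rewrite [X in _ - X - _ - _]exchange_big [X in _ - _ - X - _]exchange_big /=.
  rewrite [X in _ - _ - _ - X]exchange_big /=.
  have -> : \sum_j \sum_e G i e j * F j k l e = \sum_j \sum_e F j k l e * G i e j.
    by apply: eq_bigr => j _; apply: eq_bigr => e _; rewrite mulrC.
  have -> : \sum_j \sum_e G i l j * F e k j e = f * \sum_e G i l e * g e k.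
    by rewrite mulr_sumr; apply: eq_bigr => j _; rewrite -mulr_sumr ricE mulrCA.
  have -> : \sum_j \sum_e G i k j * F e j l e = f * \sum_e G i k e * g l e.
    by rewrite mulr_sumr; apply: eq_bigr => j _; rewrite -mulr_sumr ricE mulrCA.
  by ring.
by ring.
Qed.

Lemma einstein_schur m (n3 : n = m.+3) (char0 : forall m (x : A), m.+1%:R * x = 0 -> x = 0)
   f i : ric = f *: g -> D i f = 0.
Proof.
move=> einstein; apply: (char0 m).
pose B k l j := nabla_curv i j k l j + nabla_curv j k i l j + nabla_curv k i j l j.
have B0 k l j : B k l j = 0.
  rewrite /B; move: (nabla_curv_bianchi i j k); generalize nabla_curv => F.
  by move=> /matrixP/(_ l j); rewrite !mxDE => ->; rewrite mxE.
have C : trace_g (fun k l => \sum_j B k l j) = 0.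
  by apply: trace_g_antisym => k l; rewrite !big1 ?oppr0.
rewrite -C.
have -> : trace_g (fun k l => \sum_j B k l j) =
  trace_g (fun k l => D i f * g k l + \sum_j nabla_curv j k i l j - D k f * g l i).
  apply: eq_trace_g => k l; rewrite /B !big_split /=.
  have E1 := nabla_curv_contr i k l einstein; rewrite E1 gentry; congr (_ + _).
  rewrite -(nabla_curv_contr k i l einstein) -sumrN.
  by apply: eq_bigr => j _; rewrite nabla_curvC mxNE.
rewrite !(trace_gD, trace_gN) trace_gZ trace_g_g trace_g_gr.
have -> : trace_g (fun k l => \sum_j nabla_curv j k i l j) = - D i f.
  transitivity (\sum_k \sum_j (N *m nabla_curv j k i) k j).
    apply: eq_bigr => k _; under eq_bigr do rewrite mulr_sumr.
    by rewrite exchange_big; apply: eq_bigr => j _; rewrite mxE.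
  transitivity (- trace_g (fun j l => D j f * g l i)); last by rewrite trace_g_gr.
  under eq_bigr do under eq_bigr do rewrite nabla_curv_skew mxNE mxE.
  rewrite /trace_g exchange_big -sumrN; apply: eq_bigr => j _.
  rewrite sumrN; congr (- _); rewrite exchange_big; apply: eq_bigr => l _.
  rewrite -(nabla_curv_contr j i l einstein) mulr_sumr; apply: eq_bigr => k _.
  by rewrite [_^T _ _]mxE mulrC Nentry.
have -> : n%:R = m.+1%:R + 2 :> A by rewrite n3 -natrD addn2.
by ring.
Qed.

(** * Homothetic fields of an Einstein metric *)

Definition nabla_vec (v : 'rV[A]_n) : 'M[A]_n :=
  \matrix_(i, k) (dermx i v + v *m G i) 0 k.

Definition nabla_end i (X : 'M[A]_n) := dermx i X - G i *m X + X *m G i.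

Lemma nabla_vec_comm v i j k :
  nabla_end i (nabla_vec v) j k - nabla_end j (nabla_vec v) i k = (v *m curv i j) 0 k.
Proof.
have E a b : nabla_end a (nabla_vec v) b k =
    (dermx a (dermx b v + v *m G b) + (dermx b v + v *m G b) *m G a) 0 k
    - \sum_l G a b l * nabla_vec v l k.
  have KE x : nabla_vec v b x = (dermx b v + v *m G b) 0 x by rewrite mxE.
  have -> : \sum_l G a b l * nabla_vec v l k = (G a *m nabla_vec v) b k by rewrite [RHS]mxE.
  have -> : (nabla_end a (nabla_vec v)) b k =
      D a (nabla_vec v b k) - (G a *m nabla_vec v) b k + (nabla_vec v *m G a) b k.
    by rewrite /nabla_end !mxlinE [dermx _ _ _ _]mxE.
  have -> : (nabla_vec v *m G a) b k = ((dermx b v + v *m G b) *m G a) 0 k.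
    by rewrite [LHS]mxE [RHS]mxE; apply: eq_bigr => l _; rewrite KE.
  rewrite KE; move: (dermx b v + v *m G b) => r.
  by rewrite mxDE [dermx _ _ _ _]mxE; ring.
rewrite !E.
have -> : \sum_l G i j l * nabla_vec v l k = \sum_l G j i l * nabla_vec v l k.
  by apply: eq_bigr => l _; rewrite Gtors.
have <- : (dermx i (dermx j v + v *m G j) + (dermx j v + v *m G j) *m G i)
    - (dermx j (dermx i v + v *m G i) + (dermx i v + v *m G i) *m G j)
    = v *m curv i j.
  rewrite !(dermxD, dermxM) (dermxC i j) /curv.
  rewrite !(mulmxDl, mulmxDr, mulmxN, mulmxA).
  by apply/rowP => a; rewrite !mxlinE; ring.
by rewrite [RHS]mxDE [in RHS]mxNE; ring.
Qed.

(* The logarithmic derivative of sqrt |det g|; that it is closed makes the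
   double divergence of a bivector vanish. *)
Let gamma j := \sum_k G k j k.

(** Skewness with respect to g makes [curv i j] trace-free, and its trace is D_i gamma_j - D_j
    gamma_i because the quadratic terms have equal traces. *)
Lemma gamma_closed i j : D i (gamma j) = D j (gamma i).
Proof.
have tr0 : \tr (curv i j) = 0.
  apply: half_eq0; rewrite -{1}[curv i j]mulmx1 -gN mulmxA curv_skew.
  rewrite mulNmx -mulmxA.
  have -> : \tr (- (g *m ((curv i j)^T *m N))) = - \tr (curv i j).
    rewrite -scaleN1r mxtraceZ mulN1r mxtrace_mulC -mulmxA (mulmx1C gN) mulmx1.
    by rewrite mxtrace_tr.
  by rewrite addNr.
have cE k : curv i j k k = D i (G k j k) - D j (G k i k)
    + ((G j *m G i) k k - (G i *m G j) k k).
  by rewrite /curv !mxlinE ![dermx _ _ _ _]mxE (Gtors j) (Gtors i); ring.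
move: tr0; rewrite /mxtrace; under eq_bigr do rewrite cE.
rewrite big_split sumrB -!der_sum /= sumrB.
have -> : \sum_k (G j *m G i) k k = \sum_k (G i *m G j) k k.
  exact: mxtrace_mulC.
by rewrite subrr addr0 => /eqP; rewrite subr_eq0 => /eqP.
Qed.

Lemma einstein_homothety v s f : ric = f *: g -> (forall i, D i f = 0) ->
  (forall i, D i s = 0) -> nabla_vec v *m g + (nabla_vec v *m g)^T = (s + s) *: g ->
  n%:R * (f * s) = 0.
Proof.
move=> einstein Df Ds homo.
set K := nabla_vec v in homo *.
(* [B] is the bivector part of nabla v, and [beta] its divergence, which the
   traced Ricci identity identifies with Ric(v). *)
pose Om := K - s%:M.
pose B := N *m Om.
have Ba i j : B j i = - B i j.
  have OmE : Om *m g = - (g *m Om^T).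
    apply/eqP; rewrite -addr_eq0 /Om mulmxBl trmxD trmxN tr_scalar_mx mulmxBr.
    rewrite addrACA -opprD mul_scalar_mx mul_mx_scalar -scalerDl -homo.
    by rewrite trmx_mul gsym subrr.
  have BT : B = - B^T.
    rewrite /B trmx_mul Nsym -[N *m Om]mulmx1 -gN mulmxA -(mulmxA N) OmE.
    by rewrite mulmxN mulNmx mulmxA (mulmx1C gN) mul1mx.
  by rewrite {1}BT mxNE mxE.
pose beta m := \sum_i (D i (B m i) + gamma i * B m i).
have trK : \tr K = n%:R * s.
  apply/eqP; rewrite -subr_eq0; apply/eqP; apply: half_eq0.
  have := congr1 (fun X => \tr (X *m N)) homo.
  rewrite mulmxDl mxtraceD -mulmxA gN mulmx1 trmx_mul gsym mxtrace_mulC mulmxA.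
  rewrite (mulmx1C gN) mul1mx mxtrace_tr -scalemxAl gN mxtraceZ mxtrace1.
  by move=> E; rewrite addrACA E; ring.
have trKE : \tr K = \sum_m (D m (v 0 m) + gamma m * v 0 m).
  rewrite big_split /= /mxtrace /gamma.
  have KE i : K i i = D i (v 0 i) + \sum_l v 0 l * G i l i.
    by rewrite mxE mxDE [dermx _ _ _ _]mxE [(_ *m _) _ _]mxE.
  under [LHS]eq_bigr do rewrite KE.
  rewrite big_split /=; congr (_ + _); rewrite exchange_big.
  by apply: eq_bigr => l _; rewrite mulr_suml; apply: eq_bigr => k _; rewrite mulrC.
(* [N] is parallel, and so is the part [s%:M] of [K] since s is constant; hence nabla_i B is nabla_i
   K with an index raised. *)
have dB i : dermx i B = N *m nabla_end i K - B *m G i - (G i)^T *m B.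
  have dOm : dermx i Om = dermx i K.
    by rewrite /Om dermxD dermxN dermx_cst // oppr0 addr0.
  have KE : K = Om + s%:M by rewrite /Om subrK.
  have -> : nabla_end i K = dermx i K - G i *m Om + Om *m G i.
    rewrite /nabla_end {2 3}KE mulmxDr mulmxDl mul_scalar_mx mul_mx_scalar.
    by rewrite opprD addrA [in RHS]addrAC -!addrA; congr (_ + _);
      rewrite [RHS]addrC; congr (_ + _); rewrite addrCA addNr addr0.
  rewrite /B dermxM dOm derN_inv; generalize Om (dermx i K) => O dK.
  rewrite !(mulmxDl, mulmxDr, mulNmx, mulmxN, mulmxA).
  by apply/matrixP => a b; rewrite !mxlinE; ring.
have trcov j : \sum_i nabla_end j K i i = 0.
  have -> : \sum_i nabla_end j K i i = \tr (nabla_end j K) by [].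
  rewrite /nabla_end !mxtraceD -scaleN1r mxtraceZ mulN1r (mxtrace_mulC K) subrK.
  have -> : \tr (dermx j K) = D j (\tr K).
    by rewrite /mxtrace der_sum; apply: eq_bigr => i _; rewrite [LHS]mxE.
  by rewrite trK DM der_nat Ds mul0r mulr0 addr0.
have trric j : \sum_i (v *m curv i j) 0 i = f * (v *m g) 0 j.
  have -> : f * (v *m g) 0 j = (v *m ric) 0 j.
    by rewrite einstein -scalemxAr mxZE.
  rewrite [RHS]mxE; under eq_bigr do rewrite mxE.
  rewrite exchange_big; apply: eq_bigr => l _.
  by rewrite -mulr_sumr; congr (_ * _); rewrite mxE.
have betaE m : beta m = f * v 0 m.
  have -> : f * v 0 m = \sum_j N m j * (f * (v *m g) 0 j).
    rewrite -[v in LHS]mulmx1 -gN mulmxA mxE mulr_sumr.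
    by apply: eq_bigr => j _; rewrite (Nentry j m); ring.
  have dBE i : D i (B m i) = (N *m nabla_end i K) m i - (B *m G i) m i
      - ((G i)^T *m B) m i.
    have -> : D i (B m i) = dermx i B m i by rewrite [RHS]mxE.
    by rewrite dB !mxlinE.
  rewrite /beta; under eq_bigr do rewrite dBE.
  rewrite big_split !sumrB /=.
  (* Symbols symmetric in their lower indices are contracted with the antisymmetric [B]. *)
  have -> : \sum_i ((G i)^T *m B) m i = 0.
    under eq_bigr do rewrite mxE.
    apply: sum_antisym => i j; rewrite ![_^T _ _]mxE (Gtors j i) (Ba i j).
    by rewrite mulrN opprK.
  have -> : \sum_i (B *m G i) m i = \sum_i gamma i * B m i.
    under eq_bigr do rewrite mxE.
    rewrite exchange_big; apply: eq_bigr => l _; rewrite mulr_suml.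
    by apply: eq_bigr => i _; rewrite mulrC.
  rewrite subr0 subrK; under eq_bigr do rewrite mxE.
  rewrite exchange_big; apply: eq_bigr => j _; rewrite -mulr_sumr -trric.
  congr (_ * _).
  (* The added trace of nabla_j K is D_j of the constant n s, hence zero; it completes the traced
     Ricci identity for v. *)
  transitivity (\sum_i ((v *m curv i j) 0 i + nabla_end j K i i)).
    by apply: eq_bigr => i _; rewrite -nabla_vec_comm -/K subrK.
  by rewrite big_split /= trcov addr0.
have div0 : \sum_m (D m (beta m) + gamma m * beta m) = 0.
  transitivity (\sum_m \sum_i (D m (D i (B m i)) + D m (gamma i) * B m i
     + (gamma i * D m (B m i) + gamma m * D i (B m i)) + gamma m * gamma i * B m i)).
    apply: eq_bigr => m _; rewrite der_sum mulr_sumr -big_split.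
    by apply: eq_bigr => i _ /=; rewrite DD DM; ring.
  (* Each coefficient of B or of its derivatives is symmetric in the two indices: second derivatives
     commute, [gamma] is closed, and the remaining terms are visibly symmetric. *)
  apply: sum_antisym => i j; rewrite (DC j i) (gamma_closed j i) !(Ba i j) !derN.
  by ring.
rewrite mulrCA -trK trKE mulr_sumr -[RHS]div0; apply: eq_bigr => m _.
by rewrite betaE DM Df; ring.
Qed.

Definition lie (v : 'rV[A]_n) (X : 'M[A]_n) : 'M[A]_n := \matrix_(a, b)
  \sum_c (v 0 c * D c (X a b) + X c b * D a (v 0 c) + X a c * D b (v 0 c)).

Lemma lie_metric v : lie v g = nabla_vec v *m g + (nabla_vec v *m g)^T.
Proof.
have E a b : (nabla_vec v *m g) a b =
    \sum_c g c b * D a (v 0 c) + \sum_l v 0 l * (G l *m g) a b.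
  rewrite mxE; under eq_bigr do rewrite mxE mxDE [dermx _ _ _ _]mxE
    [(_ *m _) _ _]mxE mulrDl.
  rewrite big_split /=; congr (_ + _); first by apply: eq_bigr => c _; rewrite mulrC.
  under eq_bigr do rewrite mulr_suml.
  rewrite exchange_big; apply: eq_bigr => l _; rewrite mxE mulr_sumr.
  by apply: eq_bigr => k _; rewrite (Gtors a l) mulrA.
apply/matrixP => a b; rewrite [RHS]mxDE [_^T a b]mxE !E [LHS]mxE !big_split /=.
have -> : \sum_c v 0 c * D c (g a b)
    = \sum_l v 0 l * (G l *m g) a b + \sum_l v 0 l * (G l *m g) b a.
  rewrite -big_split; apply: eq_bigr => c _ /=; rewrite -mulrDr; congr (_ * _).
  have /matrixP/(_ a b) := Gcompat c; rewrite mxDE [in LHS]mxE => ->.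
  by congr (_ + _); rewrite -{1}gsym -trmx_mul mxE.
have -> : \sum_c g a c * D b (v 0 c) = \sum_c g c a * D b (v 0 c).
  by apply: eq_bigr => c _; rewrite gentry.
by ring.
Qed.

Lemma nabla_form_lower v a b : nabla_form (fun k => (v *m g) 0 k) a b = (nabla_vec v *m g) a b.
Proof.
have E : dermx a (v *m g) - v *m g *m (G a)^T = (dermx a v + v *m G a) *m g.
  by rewrite dermxM Gcompat mulmxDr mulmxDl !mulmxA addrA addrK.
transitivity ((dermx a (v *m g) - v *m g *m (G a)^T) 0 b).
  rewrite mxDE mxNE [dermx _ _ _ _]mxE [(_ *m _^T) _ _]mxE; congr (_ - _).
  by apply: eq_bigr => k _; rewrite [_^T _ _]mxE mulrC.
by rewrite E !mxE; apply: eq_bigr => k _; rewrite [nabla_vec _ _ _]mxE.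
Qed.

End Connection.

(** * The Levi-Civita connection and its Ricci tensor *)

Section LeviCivita.
Context (g N : 'M[A]_n).
Hypothesis gsym : g^T = g.
Hypothesis gN : g *m N = 1%:M.

Definition lc_symbol k i j :=
  half * \sum_l N k l * (D i (g j l) + D j (g i l) - D l (g i j)).

Definition levi_civita i : 'M[A]_n := \matrix_(j, k) lc_symbol k i j.

Definition lc_ric : 'M[A]_n := \matrix_(i, j)
  (\sum_k (D k (lc_symbol k i j) - D j (lc_symbol k i k))
   + \sum_k \sum_l (lc_symbol k k l * lc_symbol l i j - lc_symbol k j l * lc_symbol l i k)).

Lemma lc_tors i j k : levi_civita i j k = levi_civita j i k.
Proof.
rewrite !mxE /lc_symbol; congr (_ * _); apply: eq_bigr => l _.
by rewrite (gentry gsym i j) (addrC (D i (g j l))).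
Qed.

Lemma lc_lower i j k :
  (levi_civita i *m g) j k = half * (D i (g j k) + D j (g i k) - D k (g i j)).
Proof.
pose w : 'rV[A]_n := \row_l (D i (g j l) + D j (g i l) - D l (g i j)).
transitivity (half * (w *m N *m g) 0 k); last first.
  by rewrite -mulmxA (mulmx1C gN) mulmx1 [w _ _]mxE.
rewrite [LHS]mxE [(w *m N *m g) _ _]mxE mulr_sumr; apply: eq_bigr => m _.
rewrite mulrA; congr (_ * _); rewrite [LHS]mxE /lc_symbol [(w *m N) _ _]mxE.
congr (_ * _); apply: eq_bigr => l _.
by rewrite [w _ _]mxE mulrC (Nentry gsym gN).
Qed.

Lemma lc_compat i : dermx i g = levi_civita i *m g + g *m (levi_civita i)^T.
Proof.
apply/matrixP => j k; rewrite mxDE [LHS]mxE.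
have -> : (g *m (levi_civita i)^T) j k = (levi_civita i *m g) k j.
  by rewrite -{1}gsym -trmx_mul mxE.
rewrite !lc_lower (gentry gsym k j) (gentry gsym k i) (gentry gsym j i).
by rewrite -[LHS]mul1r -half2; ring.
Qed.

Lemma lc_ricE : lc_ric = ric levi_civita.
Proof.
apply/matrixP => i j; rewrite [LHS]mxE [RHS]mxE -big_split.
apply: eq_bigr => k _; rewrite /curv !mxDE !mxNE ![dermx _ _ _ _]mxE /=.
rewrite ![levi_civita _ _ _]mxE ![(levi_civita _ *m levi_civita _) _ _]mxE -[RHS]addrA -sumrB.
have chrC a b c : lc_symbol a b c = lc_symbol a c b by have := lc_tors c b a; rewrite !mxE.
rewrite (chrC k j i) (chrC k k i); congr (_ + _).
apply: eq_bigr => l _; rewrite ![levi_civita _ _ _]mxE.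
rewrite (chrC l j i) (chrC k j l) (chrC l k i); ring.
Qed.

End LeviCivita.
Lemma lie_scale v e (X : 'M[A]_n) :
  lie v (e *: X) = (\sum_c v 0 c * D c e) *: X + e *: lie v X.
Proof.
apply/matrixP => a b; rewrite [RHS]mxDE !mxZE ![lie _ _ _ _]mxE mulr_suml mulr_sumr.
by rewrite -big_split; apply: eq_bigr => c _ /=; rewrite !mxZE DM; ring.
Qed.

(** An abstract differential ring has no exponential: [e] and [e'] stand for e^(2u) and e^(-2u),
    known only through [ee'] and [De]. The row [v] is the vector xi, so [v *m g] is the associated
    covector. *)
Theorem einstein_cky_rs m (n3 : n = m.+3)
  (char0 : forall k (x : A), k.+1%:R * x = 0 -> x = 0)
  (g N : 'M[A]_n) (gsym : g^T = g) (gN : g *m N = 1%:M)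
  (Y : 'M[A]_n) (Ya : Y^T = - Y) (v : 'rV[A]_n) (z : 'I_n -> 'I_n -> 'I_n -> A)
  (za12 : forall a b c, z b a c = - z a b c)
  (za23 : forall a b c, z a c b = - z a b c)
  (cky : forall a b c, nabla_mx (levi_civita g N) c Y a b =
     g c a * (v *m g) 0 b - g c b * (v *m g) 0 a + z a b c)
  (L : A) (einstein : lc_ric g N = L *: g)
  (e e' u lam : A) (ee' : e * e' = 1) (De : forall i, D i e = e * (D i u + D i u))
  (Dlam : forall i, D i lam = 0)
  (soliton : lc_ric (e *: g) (e' *: N) + half *: lie v (e *: g) = lam *: (e *: g)) :
  let s := \sum_c v 0 c * D c u in
  [/\ lc_ric (e *: g) (e' *: N) = (lam - s) *: (e *: g),
      forall i, D i s = 0 & n%:R * ((lam - s) * s) = 0].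
Proof.
move=> s.
have hsym : (e *: g)^T = e *: g.
  by apply/matrixP => a b; rewrite [LHS]mxE !mxZE (gentry gsym).
have hN : (e *: g) *m (e' *: N) = 1%:M.
  by rewrite -scalemxAl -scalemxAr scalerA gN ee' scale1r.
have lieg : lie v g = 0.
  rewrite (lie_metric gsym (lc_tors _ gsym) (lc_compat gsym gN)).
  apply/matrixP => a b; rewrite mxDE [_^T _ _]mxE [RHS]mxE.
  rewrite -!(nabla_form_lower (lc_compat gsym gN)).
  rewrite lc_ricE // in einstein.
  exact: (cky_einstein_killing gsym gN (lc_tors _ gsym) (lc_compat gsym gN) Ya za12
    za23 cky einstein n3 char0).
have lieh : lie v (e *: g) = (s + s) *: (e *: g).
  rewrite lie_scale lieg scaler0 addr0 scalerA; congr (_ *: _).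
  rewrite -big_split mulr_suml; apply: eq_bigr => c _ /=; rewrite De; ring.
have ricE : lc_ric (e *: g) (e' *: N) = (lam - s) *: (e *: g).
  rewrite scalerBl -soliton lieh scalerA mulrDr -mulrDl half2 mul1r.
  by rewrite addrK.
have ricE' := ricE; rewrite lc_ricE // in ricE'.
have Ds i : D i s = 0.
  have := einstein_schur hsym hN (lc_tors _ hsym) (lc_compat hsym hN) n3 char0 i ricE'.
  by rewrite DD derN Dlam add0r => /eqP; rewrite oppr_eq0 => /eqP.
split=> //.
apply: (einstein_homothety hsym hN (lc_tors _ hsym) (lc_compat hsym hN) (v := v) ricE' _ Ds).
  by move=> i; rewrite DD derN Dlam Ds subr0.
by rewrite -(lie_metric hsym (lc_tors _ hsym) (lc_compat hsym hN)) lieh.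
Qed.

End DifferentialRing.

(** * Partial derivatives and the chain rule *)

Section Lines.
Context {R : realType} {V : normedModType R}.
Implicit Types (f : V -> R) (x v : V) (s t : R).

Lemma is_derive_line f x v t : derivable f (x + t *: v) v ->
  is_derive t (1 : R) (fun s => f (x + s *: v)) ('D_v f (x + t *: v)).
Proof.
move=> fd; set F := fun s => _.
have E : (fun h => h^-1 *: ((F \o shift t) (h *: (1 : R)) - F t))
  = (fun h => h^-1 *: ((f \o shift (x + t *: v)) (h *: v) - f (x + t *: v))).
  apply/funext => h; rewrite /F /=; congr (_ *: (f _ - _)).
  by rewrite [h *: 1]mulr1 scalerDl addrCA addrA.
by split; [rewrite /derivable E | rewrite /derive E].
Qed.

Lemma mvt_line f x v t :
  (forall s, `|s| <= `|t| -> derivable f (x + s *: v) v) ->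
  exists2 c, `|c| <= `|t| & f (x + t *: v) - f x = t * 'D_v f (x + c *: v).
Proof.
move=> fd; have dF s : `|s| <= `|t| ->
    is_derive s (1 : R) (fun s => f (x + s *: v)) ('D_v f (x + s *: v)).
  by move=> /fd; exact: is_derive_line.
have cF a b : (forall s, s \in `[a, b] -> `|s| <= `|t|) ->
    {within `[a, b], continuous (fun s => f (x + s *: v))}.
  by move=> ab; apply: derivable_within_continuous => s /ab/dF[].
have [t0|t0] := leP 0 t.
  have H r : r \in `[0, t] -> `|r| <= `|t|.
    by rewrite in_itv /= => /andP[sge0 st]; rewrite !ger0_norm.
  have [c cI] := MVT_segment t0
    (fun s sI => dF s (H s (subset_itv_oo_cc sI))) (cF _ _ H).
  rewrite scale0r addr0 subr0 mulrC => E; exists c => //; exact: H.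
have H r : r \in `[t, 0] -> `|r| <= `|t|.
  by rewrite in_itv /= => /andP[ts sge0]; rewrite !ler0_norm ?lerN2 // ltW.
have [c cI] := MVT_segment (ltW t0)
  (fun s sI => dF s (H s (subset_itv_oo_cc sI))) (cF _ _ H).
rewrite scale0r addr0 sub0r mulrN mulrC => /eqP; rewrite -eqr_oppLR opprB => /eqP E.
exists c => //; exact: H.
Qed.

End Lines.

Section Coordinates.
Context {R : realType} {n : nat}.
Implicit Types (f : 'rV[R]_n -> R) (x y z v h : 'rV[R]_n) (U : set 'rV[R]_n).

Lemma coord_le_norm h k : `|h 0 k| <= `|h|.
Proof.
by rewrite [leRHS]/Num.Def.normr /= mx_normrE (le_bigmax _ (fun ij => `|h ij.1 ij.2|) (0, k)).
Qed.

Lemma norm_le_coord h (c : R) : 0 <= c -> (forall k, `|h 0 k| <= c) -> `|h| <= c.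
Proof.
move=> c0 hc; rewrite [leLHS]/Num.Def.normr /= mx_normrE bigmax_le // => -[i k] _.
by rewrite /= ord1.
Qed.

Let trunc_row h (k : nat) : 'rV[R]_n := \row_j (if (j < k)%N then h 0 j else 0).

(** The increment telescopes along a path parallel to the axes, with the mean value theorem on each
    leg. In the sup norm every point of the path stays within [|h|] of y. This replaces
    differentiability, since [Ck] speaks of partial derivatives only. *)
Lemma increment f y (r : R) :
  (forall z k, `|z - y| < r -> derivable f z (delta_mx 0 k)) ->
  forall h, `|h| < r -> exists p : 'I_n -> 'rV[R]_n,
    (forall k, `|p k - y| <= `|h|) /\
    f (y + h) - f y = \sum_k h 0 k * pd k f (p k).
Proof.
move=> fd h hr.
have near k (c : R) : `|c| <= `|h 0 k| ->
    `|(y + trunc_row h k) + c *: delta_mx 0 k - y| <= `|h|.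
  move=> ch; rewrite addrAC (addrAC y) subrr add0r; apply: norm_le_coord => // j.
  rewrite !mxE eqxx /=; case: (eqVneq j k) => [->|jk].
    by rewrite ltnn add0r mulr1 (le_trans ch) // coord_le_norm.
  rewrite mulr0 addr0; case: ifP => _; first exact: coord_le_norm.
  by rewrite normr0.
have /choice[c cP] k : exists c, `|c| <= `|h 0 k| /\
    f (y + trunc_row h k + h 0 k *: delta_mx 0 k) - f (y + trunc_row h k)
    = h 0 k * 'D_(delta_mx 0 k) f (y + trunc_row h k + c *: delta_mx 0 k).
  have [|c c1 c2] := @mvt_line _ _ f (y + trunc_row h k) (delta_mx 0 k) (h 0 k).
    by move=> s sh; apply: fd; apply: le_lt_trans hr; exact: near.
  by exists c.
exists (fun k : 'I_n => y + trunc_row h k + c k *: delta_mx 0 k); split.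
  by move=> k; apply: near; have [] := cP k.
have -> : y + h = y + trunc_row h n.
  by congr (_ + _); apply/rowP => j; rewrite mxE ltn_ord.
have -> : f y = f (y + trunc_row h 0) by congr f; rewrite -[LHS]addr0; congr (_ + _);
  apply/rowP => j; rewrite !mxE.
rewrite -(telescope_sumr (fun k => f (y + trunc_row h k))) // big_mkord.
apply: eq_bigr => k _; have [_ <-] := cP k; congr (f _ - _).
rewrite -addrA; congr (_ + _); apply/rowP => j; rewrite !mxE eqxx /= ltnS.
rewrite leq_eqVlt; case: (eqVneq j k) => [->|jk].
  by rewrite eqxx ltnn /= add0r mulr1.
by rewrite (_ : (j == k :> nat) = false) /= ?mulr0 ?addr0 //; apply/negbTE.
Qed.

Lemma is_derive_shift f z w v d :
  is_derive (z + w) v f d -> is_derive z v (fun y => f (y + w)) d.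
Proof.
have E : (fun s : R => s^-1 *: (((fun y => f (y + w)) \o shift z) (s *: v) - f (z + w)))
   = (fun s : R => s^-1 *: ((f \o shift (z + w)) (s *: v) - f (z + w))).
  by apply/funext => s /=; rewrite addrA.
by move=> [dz <-]; split; [rewrite /derivable E | rewrite /derive E].
Qed.

Lemma open_ball U x : open U -> U x ->
  exists2 r : R, 0 < r & forall y, `|y - x| < r -> U y.
Proof.
move=> oU Ux; have /nbhs_normP[r /= r0 rU] : nbhs x U by apply: open_nbhs_nbhs.
by exists r => // y yx; apply: rU; rewrite /ball_ /= distrC.
Qed.

(** The mean value theorem is applied first along e_i to the difference of f by h e_j, then along
    e_j to [pd i f]. *)
Lemma second_difference U f x i j (r h : R) :
  (forall y, `|y - x| < r -> U y) -> 0 <= h -> h + h < r -> Ck 2 U f ->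
  exists2 p, `|p - x| <= h + h &
    f (x + h *: delta_mx 0 i + h *: delta_mx 0 j) - f (x + h *: delta_mx 0 i)
    - (f (x + h *: delta_mx 0 j) - f x) = h * (h * pd j (pd i f) p).
Proof.
move=> rU h0 hr [fc fd].
have ne k : `|delta_mx 0 k : 'rV[R]_n| <= 1.
  apply: norm_le_coord => // l; rewrite mxE eqxx /=.
  by case: eqP; rewrite ?normr1 ?normr0.
have nr s t k l : `|s| <= h -> `|t| <= h ->
    `|x + s *: delta_mx 0 k + t *: delta_mx 0 l - x| <= h + h.
  move=> sh th; rewrite addrAC (addrAC x) subrr add0r.
  apply: le_trans (ler_normD _ _) _; rewrite !normrZ; apply: lerD.
    by rewrite -[leRHS]mulr1 ler_pM.
  by rewrite -[leRHS]mulr1 ler_pM.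
have hh : `|h| = h by rewrite ger0_norm.
pose F y := f (y + h *: delta_mx 0 j) - f y.
have dF s : `|s| <= `|h| -> is_derive (x + s *: delta_mx 0 i) (delta_mx 0 i) F
    (pd i f (x + s *: delta_mx 0 i + h *: delta_mx 0 j)
     - pd i f (x + s *: delta_mx 0 i)).
  rewrite hh => sh; apply: is_deriveB.
    apply: is_derive_shift; apply: derivableP; apply: (fd i).1.
    by apply: rU; apply: le_lt_trans (nr _ _ _ _ sh _) hr; rewrite hh.
  apply: derivableP; apply: (fd i).1; apply: rU; apply: le_lt_trans hr.
  by have := nr s 0 i i sh; rewrite scale0r addr0; apply; rewrite normr0.
have [c ch] := mvt_line (fun s sh => @ex_derive _ _ _ _ _ _ _ (dF s sh)).
rewrite /F (@derive_val _ _ _ _ _ _ _ (dF c ch)) => E1.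
have [|d dh E2] := @mvt_line _ _ (pd i f) (x + c *: delta_mx 0 i) (delta_mx 0 j) h.
  move=> s sh; apply: ((fd i).2.2 j).1; apply: rU; apply: le_lt_trans hr.
  by apply: nr; rewrite -hh.
exists (x + c *: delta_mx 0 i + d *: delta_mx 0 j); first by apply: nr; rewrite -hh.
by rewrite E1 E2.
Qed.

Lemma pdC U f x i j : open U -> U x -> Ck 2 U f ->
  pd i (pd j f) x = pd j (pd i f) x.
Proof.
move=> oU Ux fC; have [r r0 rU] := open_ball oU Ux.
have cont k l : {for x, continuous (pd k (pd l f))}.
  by have [_ /(_ l)[_ [_ /(_ k)[_ [+ _]]]]] := fC; exact.
apply/eqP; rewrite -subr_eq0 -normr_le0; apply/ler_addgt0Pl => e e0; rewrite addr0.
have e2 : 0 < e / 2 by rewrite divr_gt0.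
have /cvgrPdist_le/(_ _ e2)/nbhs_normP[r1 /= r10 P1] := cont i j.
have /cvgrPdist_le/(_ _ e2)/nbhs_normP[r2 /= r20 P2] := cont j i.
(* The mean value points lie within 2 h of x, so a third of the smallest radius suffices. *)
pose h := Num.min r (Num.min r1 r2) / 3.
have m0 : 0 < Num.min r (Num.min r1 r2) by rewrite !lt_min r0 r10 r20.
have h0 : 0 < h by rewrite divr_gt0.
have hm : h + h < Num.min r (Num.min r1 r2) by rewrite /h; lra.
have [hr h1 h2] : [/\ h + h < r, h + h < r1 & h + h < r2].
  by move: hm; rewrite !lt_min => /and3P[].
have [p pn pE] := second_difference j i rU (ltW h0) hr fC.
have [q qn qE] := second_difference i j rU (ltW h0) hr fC.
have E : pd i (pd j f) p = pd j (pd i f) q.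
  apply: (mulfI (lt0r_neq0 h0)); apply: (mulfI (lt0r_neq0 h0)).
  have swap (a b c d : R) : a - b - (c - d) = a - c - (b - d) by ring.
  apply: etrans (esym pE) _; apply: etrans _ qE; rewrite swap.
  congr (f _ - _ - _).
  exact: addrAC.
rewrite -(subrKA (pd i (pd j f) p)) {2}E.
apply: le_trans (ler_normD _ _) _; rewrite (splitr e); apply: lerD.
  by apply: P1; rewrite /ball_ /= distrC; exact: le_lt_trans h1.
by rewrite distrC; apply: P2; rewrite /ball_ /= distrC; exact: le_lt_trans h2.
Qed.

End Coordinates.

Section ChainRule.
Context {R : realType} {m n : nat}.

(** By [increment], the difference quotient of [f \o T] is a sum of quotients of the coordinates of
    T times partial derivatives of f at points tending to T x, where these are continuous. *)
Lemma is_derive_chain (W : set 'rV[R]_n) (f : 'rV[R]_n -> R)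
    (T : 'rV[R]_m -> 'rV[R]_n) (x v : 'rV[R]_m) :
  open W -> W (T x) -> Ck 1 W f ->
  (forall j, derivable (fun z => T z 0 j) x v) ->
  is_derive x v (f \o T)
    (\sum_j 'D_v (fun z => T z 0 j) x * pd j f (T x)).
Proof.
move=> oW WT [_ fd] Td; have [r r0 rW] := open_ball oW WT.
pose q j (t : R) := t^-1 *: (T (t *: v + x) 0 j - T x 0 j).
have qd j : q j t @[t --> 0^'] --> 'D_v (fun z => T z 0 j) x by exact: Td.
pose w (t : R) := T (t *: v + x) - T x.
have w0 : w t @[t --> 0^'] --> (0 : 'rV[R]_n).
  have : derivable T x v by apply/derivable_mxP => i j; rewrite ord1; exact: Td.
  move=> /derivable1P/derivable1_diffP/differentiable_continuous.
  move=> C; rewrite /w -(subrr (T x)); apply: cvgB; last exact: cvg_cst.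
  have {C} : T (t *: v + x) @[t --> (0 : R)] --> T ((0 : R) *: v + x) := C.
  rewrite scale0r add0r => C.
  exact: cvg_trans (cvg_app _ (@cvg_within _ _ _ _)) C.
(* Outside the ball the points are a dummy value; [w t] lies in the ball for t near 0. *)
have /choice[P PP] (h : 'rV[R]_n) : exists p : 'I_n -> 'rV[R]_n, `|h| < r ->
    (forall k, `|p k - T x| <= `|h|) /\
    f (T x + h) - f (T x) = \sum_k h 0 k * pd k f (p k).
  have [hr|hr] := ltP `|h| r; last by exists (fun=> 0).
  have [|p pP] := @increment _ _ f (T x) r _ h hr; last by exists p.
  by move=> z k zr; apply: (fd k).1; exact: rW.
have near_r : \forall t \near 0^', `|w t| < r.
  move/cvgrPdist_lt: w0 => /(_ r r0); apply: filterS => t.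
  by rewrite sub0r normrN.
have Pc k : P (w t) k @[t --> 0^'] --> T x.
  apply/cvgrPdist_lt => e e0; move/cvgrPdist_lt: w0 => /(_ e e0) we.
  apply: filterS2 near_r we => t tr; rewrite sub0r normrN; apply: le_lt_trans.
  by rewrite distrC; apply: (PP _ tr).1.
have L : \sum_k (q k t * pd k f (P (w t) k)) @[t --> 0^']
    --> \sum_k 'D_v (fun z => T z 0 k) x * pd k f (T x).
  apply: cvg_big => [|k _]; first exact: add_continuous.
  apply: cvgM; first exact: qd.
  by apply: continuous_cvg (Pc k); apply: (fd k).2.1.
have Q : t^-1 *: (((f \o T) \o shift x) (t *: v) - (f \o T) x) @[t --> 0^']
    --> \sum_k 'D_v (fun z => T z 0 k) x * pd k f (T x).
  apply: cvg_trans L; apply: near_eq_cvg.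
  apply: filterS near_r => t tr; have [_ E] := PP _ tr.
  have -> : ((f \o T) \o shift x) (t *: v) = f (T x + w t).
    by rewrite /= /w (addrC (T x)) subrK.
  rewrite E scaler_sumr; apply: eq_bigr => k _; rewrite /q /w !mxE.
  exact: esym (mulrA _ _ _).
by split; [apply/cvg_ex; eexists; exact: Q | exact: cvg_lim Q].
Qed.

End ChainRule.

Section SmoothFunctions.
Context {R : realType} {n : nat} (U : set 'rV[R]_n) (oU : open U).
Implicit Types (f : 'rV[R]_n -> R) (x : 'rV[R]_n).

Lemma near_on x f1 f2 : (forall y, U y -> f1 y = f2 y) -> U x ->
  \forall y \near x, f1 y = f2 y.
Proof.
by move=> f12 Ux; apply: filterS (open_nbhs_nbhs (conj oU Ux)) => y /f12.
Qed.

Lemma pd_ext f1 f2 i x : (forall y, U y -> f1 y = f2 y) -> U x ->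
  pd i f1 x = pd i f2 x.
Proof. by move=> f12 Ux; apply: near_eq_derive; exact: near_on. Qed.

Lemma continuous_ext f1 f2 x : (forall y, U y -> f1 y = f2 y) -> U x ->
  {for x, continuous f1} -> {for x, continuous f2}.
Proof.
move=> f12 Ux fc; have fx : f1 @ x --> f1 x := fc.
have : f2 @ x --> f2 x; last by [].
rewrite -(f12 x Ux); apply: (cvg_trans _ fx).
exact: near_eq_cvg (near_on f12 Ux).
Qed.

Lemma Ck_ext k f1 f2 : (forall x, U x -> f1 x = f2 x) -> Ck k U f1 -> Ck k U f2.
Proof.
elim: k f1 f2 => [|k IH] f1 f2 f12 [fc fd].
  by split=> // x Ux; apply: (continuous_ext f12 Ux); exact: fc.
split=> [x Ux|i]; first by apply: (continuous_ext f12 Ux); exact: fc.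
have [d1 d2] := fd i; split.
  by move=> x Ux; apply: near_eq_derivable (d1 x Ux); exact: near_on.
by apply: IH d2 => x Ux; exact: pd_ext.
Qed.

Lemma CkS k f : Ck k.+1 U f -> Ck k U f.
Proof.
elim: k f => [|k IH] f [fc fd]; split=> // i; have [d1 d2] := fd i; split=> //.
exact: IH.
Qed.

(** The induction step of the closure lemmas: as U is open, a formula for the partial derivatives
    valid on U may replace [pd i f]. *)
Lemma Ck_is_derive k f (df : 'I_n -> 'rV[R]_n -> R) :
  (forall x, U x -> {for x, continuous f}) ->
  (forall i x, U x -> is_derive x (delta_mx 0 i : 'rV[R]_n) f (df i x)) ->
  (forall i, Ck k U (df i)) -> Ck k.+1 U f.
Proof.
move=> fc fd dfk; split=> // i; split=> [x /(fd i)[]//|].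
by apply: Ck_ext (dfk i) => x /(fd i)[_ <-].
Qed.

Lemma Ck_continuous k f x : Ck k U f -> U x -> {for x, continuous f}.
Proof. by case: k => [|k] [fc _] /fc. Qed.

Lemma CkS_is_derive k f i x : Ck k.+1 U f -> U x ->
  is_derive x (delta_mx 0 i : 'rV[R]_n) f (pd i f x).
Proof. by move=> [_ /(_ i)[fd _]] /fd; exact: derivableP. Qed.

Lemma CkS_pd k f i : Ck k.+1 U f -> Ck k U (pd i f).
Proof. by move=> [_ /(_ i)[]]. Qed.

Lemma Ck_cst k (c : R) : Ck k U (fun=> c).
Proof.
elim: k c => [|k IH] c; first by split=> // x _; exact: cst_continuous.
apply: (Ck_is_derive (df := fun _ _ => 0)) => [x _|i].
- exact: cst_continuous.
- exact: IH.
Qed.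

Lemma CkD k f1 f2 : Ck k U f1 -> Ck k U f2 -> Ck k U (fun x => f1 x + f2 x).
Proof.
elim: k f1 f2 => [|k IH] f1 f2 C1 C2.
  by split=> // x Ux; exact: (cvgD (Ck_continuous C1 Ux) (Ck_continuous C2 Ux)).
apply: (Ck_is_derive (df := fun i x => pd i f1 x + pd i f2 x)) => [x Ux|i x Ux|i].
- by exact: (cvgD (Ck_continuous C1 Ux) (Ck_continuous C2 Ux)).
- by apply: is_deriveD; [exact: CkS_is_derive C1 Ux | exact: CkS_is_derive C2 Ux].
- by apply: IH; exact: CkS_pd.
Qed.

Lemma CkM k f1 f2 : Ck k U f1 -> Ck k U f2 -> Ck k U (fun x => f1 x * f2 x).
Proof.
elim: k f1 f2 => [|k IH] f1 f2 C1 C2.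
  by split=> // x Ux; exact: (cvgM (Ck_continuous C1 Ux) (Ck_continuous C2 Ux)).
apply: (Ck_is_derive (df := fun i x => f1 x * pd i f2 x + f2 x * pd i f1 x)) => [x Ux|i x Ux|i].
- by exact: (cvgM (Ck_continuous C1 Ux) (Ck_continuous C2 Ux)).
- by apply: is_deriveM; [exact: CkS_is_derive C1 Ux | exact: CkS_is_derive C2 Ux].
- by apply: CkD; apply: IH; (exact: CkS || exact: CkS_pd).
Qed.

Lemma CkN k f : Ck k U f -> Ck k U (fun x => - f x).
Proof.
move=> fC; apply: Ck_ext (CkM (Ck_cst k (-1)) fC) => x _; exact: mulN1r.
Qed.

Lemma CkV k f : (forall x, U x -> f x != 0) -> Ck k U f -> Ck k U (fun x => (f x)^-1).
Proof.
move=> f0; elim: k => [|k IH] fC.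
  by split=> // x Ux; exact: (cvgV (f0 x Ux) (Ck_continuous fC Ux)).
apply: (Ck_is_derive (df := fun i x => - ((f x)^-1 * (f x)^-1 * pd i f x))) => [x Ux|i x Ux|i].
- by exact: (cvgV (f0 x Ux) (Ck_continuous fC Ux)).
- have [d1 d2] := CkS_is_derive i fC Ux; split; first by apply: derivableV => //; exact: f0.
  by rewrite deriveV ?f0 // d2 -invfM scaleNr.
- by apply: CkN; apply: CkM; [apply: CkM; apply: IH; exact: CkS | exact: CkS_pd].
Qed.

Lemma is_derive_exp f x v d : is_derive x v f d ->
  is_derive x v (fun y => expR (f y)) (expR (f x) * d).
Proof.
move=> [fd <-].
pose F (t : R) := f (t *: v + x).
have dF : derivable F (0 : R) (1 : R) := (derivable1P f x v).1 fd.
(* Difference quotients along v are those of a function of one variable. The case [g = id] gives the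
   derivative of f, the case [g = expR] reduces the claim to the one-variable chain rule. *)
have E g : (fun t : R => t^-1 *: (((g \o F) \o shift 0) (t *: 1) - (g \o F) 0))
    = (fun t : R => t^-1 *: (((g \o f) \o shift x) (t *: v) - (g \o f) x)) :> (R -> R).
  apply/funext => t; rewrite /F /= addr0 scale0r add0r.
  by rewrite [t *: 1]mulr1.
have DF : 'D_v f x = 'D_1 F 0.
  exact: (esym (congr1 (fun q : R -> R => lim (q @ 0^')) (E id))).
have F0 : F 0 = f x by rewrite /F scale0r add0r.
have [e1 e2] : is_derive (0 : R) (1 : R) (expR \o F) (expR (f x) * 'D_v f x).
  rewrite -F0 DF; apply: is_derive1_comp; exact: derivableP.
split; first by move: e1; rewrite /derivable (E expR).
by rewrite -e2; exact: (esym (congr1 (fun q : R -> R => lim (q @ 0^')) (E expR))).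
Qed.

Lemma Ck_exp k f : Ck k U f -> Ck k U (fun x => expR (f x)).
Proof.
have ce x : {for x, continuous f} -> {for x, continuous (fun y => expR (f y))}.
  by move=> fc; apply: continuous_cvg fc; exact: continuous_expR.
elim: k => [|k IH] fC; first by split=> // x Ux; apply: ce; exact: Ck_continuous fC Ux.
apply: (Ck_is_derive (df := fun i x => expR (f x) * pd i f x)) => [x Ux|i x Ux|i].
- by apply: ce; exact: Ck_continuous fC Ux.
- by apply: is_derive_exp; exact: CkS_is_derive fC Ux.
- by apply: CkM; [apply: IH; exact: CkS | exact: CkS_pd].
Qed.

Lemma smooth_ext f1 f2 : (forall x, U x -> f1 x = f2 x) ->
  smooth_on U f1 -> smooth_on U f2.
Proof. by move=> f12 f1s k; exact: Ck_ext (f1s k). Qed.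

Lemma smooth_pd f i : smooth_on U f -> smooth_on U (pd i f).
Proof. by move=> fs k; exact: CkS_pd (fs k.+1). Qed.

Lemma smooth_sum (I : Type) (r : seq I) (F : I -> 'rV[R]_n -> R) :
  (forall i, smooth_on U (F i)) -> smooth_on U (fun x => \sum_(i <- r) F i x).
Proof.
move=> Fs; elim: r => [|i r IH].
  by move=> k; apply: Ck_ext (Ck_cst k 0) => x _; rewrite big_nil.
move=> k; apply: Ck_ext (CkD (Fs i k) (IH k)) => x _; by rewrite big_cons.
Qed.

Lemma smooth_prod (I : Type) (r : seq I) (F : I -> 'rV[R]_n -> R) :
  (forall i, smooth_on U (F i)) -> smooth_on U (fun x => \prod_(i <- r) F i x).
Proof.
move=> Fs; elim: r => [|i r IH].
  by move=> k; apply: Ck_ext (Ck_cst k 1) => x _; rewrite big_nil.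
move=> k; apply: Ck_ext (CkM (Fs i k) (IH k)) => x _; by rewrite big_cons.
Qed.

Lemma smooth_det p (X : 'rV[R]_n -> 'M[R]_p) :
  (forall i j, smooth_on U (fun x => X x i j)) -> smooth_on U (fun x => \det (X x)).
Proof.
move=> Xs; apply: smooth_sum => s k; apply: CkM; first exact: Ck_cst.
exact: smooth_prod.
Qed.

Lemma smooth_invmx p (X : 'rV[R]_n -> 'M[R]_p) i j :
  (forall x, U x -> X x \in unitmx) ->
  (forall i j, smooth_on U (fun x => X x i j)) ->
  smooth_on U (fun x => invmx (X x) i j).
Proof.
move=> Xu Xs k.
apply: (@Ck_ext _ (fun x => (\det (X x))^-1 *
  ((-1) ^+ (j + i) * \det (row' j (col' i (X x)))))).
  by move=> x Ux; rewrite /invmx Xu // !mxE.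
apply: CkM; first apply: CkV => [x /Xu|].
- by rewrite unitmxE unitfE.
- exact: smooth_det.
- apply: CkM; first exact: Ck_cst.
  by apply: smooth_det => a b l;
    apply: Ck_ext (Xs (lift j a) (lift i b) l) => x _;
    rewrite !mxE.
Qed.

End SmoothFunctions.

(** * The ring of smooth functions on an open set *)

(* The values outside [U] are fixed so that equality is equality on [U]; the
   proof [oU] is a parameter because the ring structure depends on it. *)
Record smooth_map (R : realType) (n : nat) (U : set 'rV[R]_n) (oU : open U) :=
  SmoothMap {
  smooth_val :> 'rV[R]_n -> R ;
  smooth_valP : smooth_on U smooth_val ;
  smooth_val_out : forall x, ~ U x -> smooth_val x = 0
}.

Section SmoothRing.
Context {R : realType} {n : nat} (U : set 'rV[R]_n) (oU : open U).
Local Notation smooth_map := (smooth_map oU).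

Lemma smooth_map_eq (f1 f2 : smooth_map) : (forall x, U x -> f1 x = f2 x) -> f1 = f2.
Proof.
case: f1 => f1 q1 o1; case: f2 => f2 q2 o2 /= f12.
have E : f1 = f2.
  apply/funext => x; have [Ux|nUx] := pselect (U x); first exact: f12.
  by rewrite o1 // o2.
by case: _ / E q2 o2 => q2 o2; rewrite (Prop_irrelevance q1 q2) (Prop_irrelevance o1 o2).
Qed.

Definition restrict_to (f : 'rV[R]_n -> R) x := if `[<U x>] then f x else 0.

Lemma restrict_toE f x : U x -> restrict_to f x = f x.
Proof. by move=> Ux; rewrite /restrict_to asboolT. Qed.

Lemma restrict_to_smooth f : smooth_on U f -> smooth_on U (restrict_to f).
Proof. by apply: smooth_ext => // x /restrict_toE ->. Qed.

Lemma restrict_to_out f x : ~ U x -> restrict_to f x = 0.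
Proof. by move=> nUx; rewrite /restrict_to asboolF. Qed.

Definition mk_smooth f (fs : smooth_on U f) : smooth_map :=
  SmoothMap oU (restrict_to_smooth fs) (restrict_to_out f).

Lemma mk_smoothE f (fs : smooth_on U f) x : U x -> mk_smooth fs x = f x.
Proof. exact: restrict_toE. Qed.

HB.instance Definition _ := gen_eqMixin smooth_map.
HB.instance Definition _ := gen_choiceMixin smooth_map.

Definition smooth_cst (c : R) := mk_smooth (fun k => Ck_cst oU k c).
Definition smooth_add (f1 f2 : smooth_map) :=
  mk_smooth (fun k => CkD oU (smooth_valP f1 k) (smooth_valP f2 k)).
Definition smooth_mul (f1 f2 : smooth_map) :=
  mk_smooth (fun k => CkM oU (smooth_valP f1 k) (smooth_valP f2 k)).
Definition smooth_opp (f : smooth_map) :=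
  mk_smooth (fun k => CkN oU (smooth_valP f k)).

Lemma smooth_cstE c x : U x -> smooth_cst c x = c.
Proof. exact: restrict_toE. Qed.

Fact smooth_addE a b x : U x -> smooth_add a b x = a x + b x.
Proof. exact: restrict_toE. Qed.

Fact smooth_mulE a b x : U x -> smooth_mul a b x = a x * b x.
Proof. exact: restrict_toE. Qed.

Fact smooth_oppE a x : U x -> smooth_opp a x = - a x.
Proof. exact: restrict_toE. Qed.

Let opE := (smooth_addE, smooth_mulE, smooth_oppE, smooth_cstE).

Fact smooth_addA : associative smooth_add.
Proof. by move=> a b c; apply: smooth_map_eq => x Ux; rewrite !opE // addrA. Qed.

Fact smooth_addC : commutative smooth_add.
Proof. by move=> a b; apply: smooth_map_eq => x Ux; rewrite !opE // addrC. Qed.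

Fact smooth_add0 : left_id (smooth_cst 0) smooth_add.
Proof. by move=> a; apply: smooth_map_eq => x Ux; rewrite !opE // add0r. Qed.

Fact smooth_addN : left_inverse (smooth_cst 0) smooth_opp smooth_add.
Proof. by move=> a; apply: smooth_map_eq => x Ux; rewrite !opE // addNr. Qed.

HB.instance Definition _ := GRing.isZmodule.Build smooth_map
  smooth_addA smooth_addC smooth_add0 smooth_addN.

Fact smooth_mulA : associative smooth_mul.
Proof. by move=> a b c; apply: smooth_map_eq => x Ux; rewrite !opE // mulrA. Qed.

Fact smooth_mulC : commutative smooth_mul.
Proof. by move=> a b; apply: smooth_map_eq => x Ux; rewrite !opE // mulrC. Qed.

Fact smooth_mul1 : left_id (smooth_cst 1) smooth_mul.
Proof. by move=> a; apply: smooth_map_eq => x Ux; rewrite !opE // mul1r. Qed.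

Fact smooth_mulD :
  left_distributive smooth_mul (+%R : smooth_map -> smooth_map -> smooth_map).
Proof. by move=> a b c; apply: smooth_map_eq => x Ux; rewrite !opE // mulrDl. Qed.

HB.instance Definition _ := GRing.Zmodule_isComPzRing.Build smooth_map
  smooth_mulA smooth_mulC smooth_mul1 smooth_mulD.

Lemma smooth_mapD (a b : smooth_map) x : U x -> (a + b) x = a x + b x.
Proof. exact: smooth_addE. Qed.

Lemma smooth_mapM (a b : smooth_map) x : U x -> (a * b) x = a x * b x.
Proof. exact: smooth_mulE. Qed.

Lemma smooth_mapN (a : smooth_map) x : U x -> (- a) x = - a x.
Proof. exact: smooth_oppE. Qed.

Lemma smooth_map0 x : U x -> (0 : smooth_map) x = 0.
Proof. exact: smooth_cstE. Qed.

Lemma smooth_map1 x : U x -> (1 : smooth_map) x = 1.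
Proof. exact: smooth_cstE. Qed.

Lemma smooth_map_sum (I : Type) (r : seq I) (F : I -> smooth_map) x : U x ->
  (\sum_(i <- r) F i) x = \sum_(i <- r) F i x.
Proof.
move=> Ux; elim: r => [|i r IH]; first by rewrite !big_nil smooth_map0.
by rewrite !big_cons smooth_mapD // IH.
Qed.

(** Together with its companions, this evaluates a ring expression at a point by following its
    shape, each subterm bringing its own value. *)
Lemma smooth_evalD (a b : smooth_map) x (r s : R) : U x -> a x = r -> b x = s ->
  (a + b : smooth_map) x = r + s.
Proof. by move=> Ux <- <-; exact: smooth_mapD. Qed.

Lemma smooth_evalN (a : smooth_map) x (r : R) : U x -> a x = r -> (- a : smooth_map) x = - r.
Proof. by move=> Ux <-; exact: smooth_mapN. Qed.

Lemma smooth_evalB (a b : smooth_map) x (r s : R) : U x -> a x = r -> b x = s ->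
  (a - b : smooth_map) x = r - s.
Proof. by move=> Ux ar bs; apply: smooth_evalD => //; exact: smooth_evalN. Qed.

Lemma smooth_evalM (a b : smooth_map) x (r s : R) : U x -> a x = r -> b x = s ->
  (a * b : smooth_map) x = r * s.
Proof. by move=> Ux <- <-; exact: smooth_mapM. Qed.

Lemma smooth_eval_sum (I : Type) (r : seq I) (F : I -> smooth_map) (f : I -> R) x : U x ->
  (forall i, F i x = f i) -> (\sum_(i <- r) F i) x = \sum_(i <- r) f i.
Proof. by move=> Ux Ff; apply: etrans (smooth_map_sum r F Ux) _; apply: eq_bigr. Qed.

Lemma smooth_map_nat k x : U x -> (k%:R : smooth_map) x = k%:R.
Proof.
by move=> Ux; elim: k => [|k IH]; rewrite ?smooth_map0 // -!natr1 smooth_mapD // IH smooth_map1.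
Qed.

Definition spd i (a : smooth_map) : smooth_map :=
  mk_smooth (smooth_pd i (smooth_valP a)).

Lemma spdE i a x : U x -> spd i a x = pd i a x.
Proof. exact: restrict_toE. Qed.

(** A derivative at x needs agreement on all of U, which is why the evaluation hypotheses below
    quantify over every point of U. *)
Lemma spd_ext i (a : smooth_map) f x : (forall y, U y -> a y = f y) -> U x ->
  spd i a x = pd i f x.
Proof. by move=> af Ux; rewrite spdE //; exact: (pd_ext oU i af Ux). Qed.

Lemma spdD i a b : spd i (a + b) = spd i a + spd i b.
Proof.
apply: smooth_map_eq => x Ux; rewrite smooth_mapD // !spdE //.
rewrite (pd_ext oU i (f2 := fun y => a y + b y)) //; last exact: smooth_mapD.
have da := CkS_is_derive i (smooth_valP a 1%N) Ux.
have db := CkS_is_derive i (smooth_valP b 1%N) Ux.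
by have [_] := is_deriveD da db.
Qed.

Lemma spdM i a b : spd i (a * b) = spd i a * b + a * spd i b.
Proof.
apply: smooth_map_eq => x Ux; rewrite smooth_mapD // !smooth_mapM // !spdE //.
rewrite (pd_ext oU i (f2 := fun y => a y * b y)) //; last exact: smooth_mapM.
have da := CkS_is_derive i (smooth_valP a 1%N) Ux.
have db := CkS_is_derive i (smooth_valP b 1%N) Ux.
have [_ E] := is_deriveM da db; apply: etrans E _.
by rewrite addrC; congr (_ + _); rewrite [LHS]mulrC.
Qed.

Lemma spdC i j a : spd i (spd j a) = spd j (spd i a).
Proof.
apply: smooth_map_eq => x Ux.
have E k l : spd k (spd l a) x = pd k (pd l a) x.
  exact: (spd_ext k (fun y => @spdE l a y) Ux).
apply: etrans (E i j) _; apply: etrans _ (esym (E j i)).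
exact: pdC oU Ux (smooth_valP a 2%N).
Qed.

Lemma smooth_natmul_eq0 k (a : smooth_map) : k.+1%:R * a = 0 -> a = 0.
Proof.
move=> ka; apply: smooth_map_eq => x Ux; have := congr1 (fun f : smooth_map => f x) ka.
rewrite smooth_mapM // smooth_map_nat // smooth_map0 // => /eqP; rewrite mulf_eq0 pnatr_eq0 /=.
by move/eqP.
Qed.

End SmoothRing.

(* Keeps unification from unfolding ring operations down to smoothness proofs. *)
Global Opaque smooth_cst smooth_add smooth_mul smooth_opp spd mk_smooth.

(** * From identities in the ring to identities in a chart *)

Section Evaluation.
Context {R : realType} {n : nat} (U : set 'rV[R]_n) (oU : open U).
Local Notation A := (smooth_map oU).

Section Metric.
Context (h : 'rV[R]_n -> 'M[R]_n) (g N : 'M[A]_n).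
Hypothesis hg : forall i j x, U x -> g i j x = h x i j.
Hypothesis hN : forall i j x, U x -> N i j x = inv_metric h x i j.
Let D := spd (oU := oU).
Let half : A := smooth_cst oU 2^-1.

Lemma christoffel_eval k i j x : U x -> lc_symbol D half g N k i j x = christoffel h k i j x.
Proof.
move=> Ux; apply: (smooth_evalM Ux); first exact: smooth_cstE.
apply: (smooth_eval_sum _ Ux) => l; apply: (smooth_evalM Ux); first exact: hN.
apply: (smooth_evalB Ux); [apply: (smooth_evalD Ux)|];
  by apply: (spd_ext _ _ Ux) => y; exact: hg.
Qed.

Lemma lc_ric_eval i j x : U x -> lc_ric D half g N i j x = ricci h x i j.
Proof.
move=> Ux; rewrite [in LHS]mxE [in RHS]mxE; apply: (smooth_evalD Ux).
  apply: (smooth_eval_sum _ Ux) => k; apply: (smooth_evalB Ux);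
    by apply: (spd_ext _ _ Ux) => y; exact: christoffel_eval.
apply: (smooth_eval_sum _ Ux) => k; apply: (smooth_eval_sum _ Ux) => l.
by apply: (smooth_evalB Ux); apply: (smooth_evalM Ux); exact: christoffel_eval.
Qed.

Lemma nabla_mx_eval (Y : 'M[A]_n) (T : 'rV[R]_n -> 'M[R]_n) c a b x :
  (forall i j x, U x -> Y i j x = T x i j) -> U x ->
  nabla_mx D (levi_civita D half g N) c Y a b x = nabla h T c a b x.
Proof.
move=> YT Ux; have lcE i j k : levi_civita D half g N i j k x = christoffel h k i j x.
  by rewrite mxE; exact: christoffel_eval.
rewrite /nabla_mx 2!mxDE 2!mxNE; apply: (smooth_evalB Ux); first apply: (smooth_evalB Ux).
- by rewrite mxE; apply: (spd_ext _ _ Ux) => y; exact: YT.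
- by rewrite mxE; apply: (smooth_eval_sum _ Ux) => k; apply: (smooth_evalM Ux); [exact: lcE | exact: YT].
- rewrite mxE; apply: (smooth_eval_sum _ Ux) => k; rewrite [RHS]mulrC.
  by apply: (smooth_evalM Ux); [exact: YT | rewrite mxE; exact: lcE].
Qed.

Lemma lie_eval (v : 'rV[A]_n) (w : 'rV[R]_n -> 'rV[R]_n) a b x :
  (forall i x, U x -> v 0 i x = w x 0 i) -> U x ->
  lie D v g a b x = lie_tensor2 w h x a b.
Proof.
move=> vw Ux; rewrite [in LHS]mxE [in RHS]mxE; apply: (smooth_eval_sum _ Ux) => c.
apply: (smooth_evalD Ux); first apply: (smooth_evalD Ux); apply: (smooth_evalM Ux);
  by [exact: vw | exact: hg
     | apply: (spd_ext _ _ Ux) => y; first [exact: hg | exact: vw]].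
Qed.

End Metric.

Lemma mulmx_eval p q r (X : 'M[A]_(p, q)) (Z : 'M[A]_(q, r)) (X' : 'M[R]_(p, q))
    (Z' : 'M[R]_(q, r)) i j x : U x ->
  (forall i j, X i j x = X' i j) -> (forall i j, Z i j x = Z' i j) ->
  (X *m Z) i j x = (X' *m Z') i j.
Proof.
move=> Ux XX ZZ; rewrite [in LHS]mxE [in RHS]mxE; apply: (smooth_eval_sum _ Ux) => k.
by apply: (smooth_evalM Ux).
Qed.

Theorem einstein_cky_rs_chart m (n3 : n = m.+3) (h Y : 'rV[R]_n -> 'M[R]_n)
    (v : 'rV[R]_n -> 'rV[R]_n) (u : 'rV[R]_n -> R) (L lam : R)
    (H := fun x => expR (2 * u x) *: h x) :
  (forall i j, smooth_on U (fun x => h x i j)) ->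
  (forall i j, smooth_on U (fun x => Y x i j)) ->
  (forall i, smooth_on U (fun x => v x 0 i)) ->
  smooth_on U u ->
  (forall x, U x -> (h x)^T = h x /\ h x \in unitmx) ->
  (forall x, U x -> (Y x)^T = - Y x) ->
  (forall x, U x -> CKY_equation h Y x) ->
  (forall x, U x -> v x = assoc_vector h Y x) ->
  (forall x, U x -> ricci h x = L *: h x) ->
  (forall x, U x -> ricci H x + 2^-1 *: lie_tensor2 v H x = lam *: H x) ->
  [/\ forall x, U x -> ricci H x = (lam - lie_scalar v u x) *: H x,
      Ck 1 U (lie_scalar v u),
      forall i x, U x -> pd i (lie_scalar v u) x = 0 &
      forall x, U x -> (lam - lie_scalar v u x) * lie_scalar v u x = 0].
Proof.
move=> hs Ys vs us hp Ya cky assoc einst soliton.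
pose D := spd (oU := oU).
pose half : A := smooth_cst oU 2^-1.
have half2 : half + half = 1.
  apply: smooth_map_eq => x Ux; apply: etrans _ (esym (smooth_map1 oU Ux)).
  apply: etrans (smooth_evalD Ux (smooth_cstE oU _ Ux) (smooth_cstE oU _ Ux)) _.
  by rewrite -[X in X + X]mul1r -mulrDl divff ?pnatr_eq0.
pose g : 'M[A]_n := \matrix_(i, j) mk_smooth oU (hs i j).
have hN i j : smooth_on U (fun x => inv_metric h x i j).
  by apply: smooth_invmx => // x /hp[].
pose N : 'M[A]_n := \matrix_(i, j) mk_smooth oU (hN i j).
pose YA : 'M[A]_n := \matrix_(i, j) mk_smooth oU (Ys i j).
pose vA : 'rV[A]_n := \row_i mk_smooth oU (vs i).
have gE i j x : U x -> g i j x = h x i j by move=> Ux; rewrite mxE mk_smoothE.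
have NE i j x : U x -> N i j x = inv_metric h x i j.
  by move=> Ux; rewrite mxE mk_smoothE.
have YE i j x : U x -> YA i j x = Y x i j by move=> Ux; rewrite mxE mk_smoothE.
have vE i x : U x -> vA 0 i x = v x 0 i by move=> Ux; rewrite mxE mk_smoothE.
pose uA := mk_smooth oU us.
have es : smooth_on U (fun x => expR (2 * u x)).
  by move=> k; apply: Ck_exp => //; apply: CkM => //; exact: Ck_cst.
have es' : smooth_on U (fun x => (expR (2 * u x))^-1).
  by move=> k; apply: CkV => // x _; rewrite gt_eqF // expR_gt0.
pose e := mk_smooth oU es; pose e' := mk_smooth oU es'.
have gsym : g^T = g.
  apply/matrixP => i j; apply: smooth_map_eq => x Ux.
  by rewrite mxE !gE // -{2}(hp x Ux).1 mxE.
have gN : g *m N = 1%:M.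
  apply/matrixP => i j; apply: smooth_map_eq => x Ux.
  rewrite (mulmx_eval i j Ux (fun i j => gE i j x Ux) (fun i j => NE i j x Ux)).
  rewrite mulmxV ?(hp x Ux).2 // !mxE.
  by case: eqP => _; rewrite ?mulr1n ?mulr0n;
    [exact: esym (smooth_map1 oU Ux) | exact: esym (smooth_map0 oU Ux)].
have YAa : YA^T = - YA.
  apply/matrixP => i j; apply: smooth_map_eq => x Ux.
  rewrite mxNE; apply: etrans _ (esym (smooth_evalN Ux (YE i j x Ux))).
  have /matrixP/(_ i j) := Ya x Ux; rewrite mxE [X in _ = X -> _]mxE => <-.
  by rewrite mxE; exact: YE.
have vgE b x : U x -> (vA *m g) 0 b x = assoc_covector h Y x 0 b.
  move=> Ux; have vE' i j : vA i j x = v x i j by rewrite ord1 vE.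
  rewrite (mulmx_eval 0 b Ux vE' (fun i j => gE i j x Ux)).
  have [hT hU] := hp x Ux.
  have -> : v x = assoc_covector h Y x *m invmx (h x).
    rewrite assoc //; apply/rowP => i; rewrite !mxE; apply: eq_bigr => j _.
    rewrite mulrC; congr (_ * _); rewrite /inv_metric -[in LHS]hT -trmx_inv.
    by rewrite mxE.
  by rewrite mulmxKV.
(* The 3-form of [CKY_equation] is given point by point. Defined as the remainder of the equation,
   it is a ring element, hence smooth, and its antisymmetry is inherited pointwise. *)
pose z a b c := nabla_mx D (levi_civita D half g N) c YA a b - g c a * (vA *m g) 0 b
  + g c b * (vA *m g) 0 a.
have zE x : U x -> totally_antisymmetric (fun a b c => z a b c x).
  move=> Ux; have [z' z'a z'E] := cky x Ux.
  have zz a b c : z a b c x = z' a b c.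
    apply: etrans (smooth_evalD Ux (smooth_evalB Ux (nabla_mx_eval gE NE c a b YE Ux)
      (smooth_evalM Ux (gE c a x Ux) (vgE b x Ux))) (smooth_evalM Ux (gE c b x Ux) (vgE a x Ux))) _.
    by rewrite z'E; ring.
  by move=> a b c; rewrite !zz; exact: z'a.
have za12 a b c : z b a c = - z a b c.
  apply: smooth_map_eq => x Ux; apply: etrans _ (esym (smooth_mapN _ Ux)).
  exact: (zE x Ux a b c).1.
have za23 a b c : z a c b = - z a b c.
  apply: smooth_map_eq => x Ux; apply: etrans _ (esym (smooth_mapN _ Ux)).
  exact: (zE x Ux a b c).2.
have ckyA a b c : nabla_mx D (levi_civita D half g N) c YA a b =
    g c a * (vA *m g) 0 b - g c b * (vA *m g) 0 a + z a b c.
  by rewrite /z; ring.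
have einstA : lc_ric D half g N = smooth_cst oU L *: g.
  apply/matrixP => i j; apply: smooth_map_eq => x Ux.
  apply: etrans (lc_ric_eval gE NE i j Ux) _; rewrite einst // !mxZE.
  exact: esym (smooth_evalM Ux (smooth_cstE oU _ Ux) (gE i j x Ux)).
have ee' : e * e' = 1.
  apply: smooth_map_eq => x Ux; apply: etrans _ (esym (smooth_map1 oU Ux)).
  apply: etrans (smooth_evalM Ux (mk_smoothE oU es Ux) (mk_smoothE oU es' Ux)) _.
  by rewrite mulfV // gt_eqF // expR_gt0.
have De i : D i e = e * (D i uA + D i uA).
  apply: smooth_map_eq => x Ux.
  have Du : D i uA x = pd i u x.
    by apply: (spd_ext _ _ Ux) => y Uy; exact: mk_smoothE.
  apply: etrans _ (esym (smooth_evalM Ux (mk_smoothE oU es Ux) (smooth_evalD Ux Du Du))).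
  have -> : D i e x = pd i (fun y => expR (2 * u y)) x.
    by apply: (spd_ext _ _ Ux) => y Uy; exact: mk_smoothE.
  have du := CkS_is_derive i (us 1%N) Ux.
  have [_ E] := is_derive_exp (is_deriveZ 2 du); apply: etrans E _.
  by congr (_ * _); rewrite -mulr2n -[RHS]mulr_natl.
have Dlam i : D i (smooth_cst oU lam) = 0.
  apply: smooth_map_eq => x Ux; apply: etrans _ (esym (smooth_map0 oU Ux)).
  apply: etrans (derive_cst lam _ _); apply: (spd_ext _ _ Ux) => y Uy.
  exact: smooth_cstE.
have HE i j x : U x -> (e *: g) i j x = H x i j.
  move=> Ux; rewrite !mxZE.
  exact: (smooth_evalM Ux (mk_smoothE oU es Ux) (gE i j x Ux)).
have HN i j x : U x -> (e' *: N) i j x = inv_metric H x i j.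
  move=> Ux; have [hT hU] := hp x Ux; rewrite mxZE.
  apply: etrans (smooth_evalM Ux (mk_smoothE oU es' Ux) (NE i j x Ux)) _.
  rewrite /inv_metric /H.
  by rewrite invmxZ ?mxE // unitmxZ // unitfE gt_eqF // expR_gt0.
have solA : lc_ric D half (e *: g) (e' *: N) + half *: lie D vA (e *: g)
    = smooth_cst oU lam *: (e *: g).
  apply/matrixP => i j; apply: smooth_map_eq => x Ux.
  have E : ricci H x i j + 2^-1 * lie_tensor2 v H x i j = lam * H x i j.
    by rewrite -[RHS]mxZE -soliton // mxDE mxZE.
  have lE : (half *: lie D vA (e *: g)) i j x = 2^-1 * lie_tensor2 v H x i j.
    rewrite mxZE; exact: (smooth_evalM Ux (smooth_cstE oU _ Ux) (lie_eval HE i j vE Ux)).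
  rewrite mxDE; apply: etrans (smooth_evalD Ux (lc_ric_eval HE HN i j Ux) lE) _.
  apply: etrans E _; rewrite [in RHS]mxZE.
  apply: esym; apply: (smooth_evalM Ux (smooth_cstE oU _ Ux)).
  exact: HE.
have [C1 C2 C3] := einstein_cky_rs (@spdD _ _ _ oU) (@spdM _ _ _ oU) (@spdC _ _ _ oU)
  half2 n3 (@smooth_natmul_eq0 _ _ _ oU) gsym gN YAa za12 za23 ckyA einstA ee' De Dlam
  solA.
set s := \sum_c _ in C1 C2 C3.
have sE x : U x -> s x = lie_scalar v u x.
  move=> Ux; apply: (smooth_eval_sum _ Ux) => c; apply: (smooth_evalM Ux); first exact: vE.
  by apply: (spd_ext _ _ Ux) => y Uy; exact: mk_smoothE.
split.
- move=> x Ux; apply/matrixP => i j; rewrite mxZE.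
  apply: etrans (esym (lc_ric_eval HE HN i j Ux)) _; rewrite C1 mxZE.
  by apply: (smooth_evalM Ux (smooth_evalB Ux (smooth_cstE oU _ Ux) (sE x Ux))); exact: HE.
- exact: Ck_ext sE (smooth_valP s 1%N).
- move=> i x Ux; apply: etrans (esym (spd_ext i sE Ux)) _.
  by apply: etrans (congr1 (fun f : A => f x) (C2 i)) _; exact: smooth_map0.
(* The factor n = [m.+3] is cancelled, being the successor of [m.+2]. *)
- move=> x Ux; have := @smooth_natmul_eq0 _ _ _ oU m.+2 ((smooth_cst oU lam - s) * s).
  rewrite -n3 => /(_ C3)/(congr1 (fun f : A => f x)) E.
  apply: etrans (esym _) (etrans E (smooth_map0 oU Ux)).
  exact: (smooth_evalM Ux (smooth_evalB Ux (smooth_cstE oU _ Ux) (sE x Ux)) (sE x Ux)).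
Qed.

End Evaluation.

(** * Local constancy and change of charts *)

Lemma zero_pd_locally_constant (R : realType) (n : nat) (U : set 'rV[R]_n)
    (f : 'rV[R]_n -> R) (x : 'rV[R]_n) :
  open U -> U x -> Ck 1 U f -> (forall i y, U y -> pd i f y = 0) ->
  exists2 r : R, 0 < r & forall y, `|y - x| < r -> f y = f x.
Proof.
move=> oU Ux [_ fd] f0; have [r r0 rU] := open_ball oU Ux.
exists r => // y yr; have [|p [pn]] := @increment _ _ f x r _ (y - x) yr.
  by move=> z k zr; apply: (fd k).1; exact: rU.
rewrite (addrC x) subrK big1 => [/eqP|k _]; first by rewrite subr_eq0 => /eqP.
by rewrite f0 ?mulr0 //; apply: rU; exact: le_lt_trans (pn k) yr.
Qed.

Section Charts.
Context {R : realType} {n : nat} (M : manifold R n).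
Implicit Types (a b : chart M) (p q : M) (x : 'rV[R]_n).

Lemma chart_im_param a x : chart_im a x -> chart_dom a (param a x) /\ Defs.coord a (param a x) = x.
Proof. by move=> [p ap <-]; rewrite coordK. Qed.

Lemma chart_im_coord a p : chart_dom a p -> chart_im a (Defs.coord a p).
Proof. by move=> ap; exists p. Qed.

Lemma transition_pd (u : M -> R) a b p i : smooth_function u ->
  chart_dom a p -> chart_dom b p ->
  pd i (u \o param a) (Defs.coord a p) =
  \sum_j Defs.jacobian a b (Defs.coord a p) i j * pd j (u \o param b) (Defs.coord b p).
Proof.
move=> us ap bp; set x := Defs.coord a p.
have px : param a x = p by exact: coordK.
have Tx : transition a b x = Defs.coord b p by rewrite /transition px.
have xab : overlap a b x by exists p.
(* The two expressions of u are compared only where [param a z] also lies in the domain of b, which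
   holds near x. *)
have nearE : \forall z \near x, ((u \o param b) \o transition a b) z = (u \o param a) z.
  have n1 : \forall z \near x, chart_im a z.
    by apply: open_nbhs_nbhs; split; [exact: chart_im_open | exact: chart_im_coord].
  have n2 : \forall z \near x, chart_dom b (param a z).
    have pc : {for x, continuous (param a)} by apply: param_continuous; exists p.
    by apply: pc; apply: open_nbhs_nbhs; split; [exact: chart_dom_open | rewrite px].
  by apply: filterS2 n1 n2 => z za zb; rewrite /transition /= coordK.
have uC : Ck 1 (chart_im b) (u \o param b) by exact: us.
have bT : chart_im b (transition a b x) by rewrite Tx; exact: chart_im_coord.
have Td j : derivable (fun z => transition a b z 0 j) x (delta_mx 0 i).
  by have [_ /(_ i)[+ _]] := transition_smooth a b j 1%N; apply.
rewrite -[LHS](near_eq_derive _ nearE).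
have [_ ->] := is_derive_chain (@chart_im_open _ _ M b) bT uC Td.
by rewrite Tx; apply: eq_bigr => j _; rewrite mxE.
Qed.

Lemma lie_function_transition (xi : vector_field M) (u : M -> R) a b p :
  smooth_function u -> chart_dom a p -> chart_dom b p ->
  lie_function xi u a (Defs.coord a p) = lie_function xi u b (Defs.coord b p).
Proof.
move=> us ap bp; have xab : overlap a b (Defs.coord a p) by exists p.
rewrite /lie_function /lie_scalar.
have := vcomp_law xi xab; rewrite /transition coordK // => ->.
under eq_bigr do rewrite (transition_pd _ us ap bp) mulr_sumr.
rewrite exchange_big; apply: eq_bigr => j _; rewrite mxE mulr_suml.
by apply: eq_bigr => i _; rewrite mulrA.
Qed.

(** The level set through q and its complement are both open. *)
Lemma locally_constant_connected (S : M -> R) : connected [set: M] ->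
  (forall p, \forall q \near p, S q = S p) -> forall p q, S p = S q.
Proof.
move=> conn loc p q.
have [oB cB] : open [set z | S z = S q] /\ open (~` [set z | S z = S q]).
  by split; rewrite openE => z /= zq; apply: filterS (loc z) => w /= ->.
suff E : [set z | S z = S q] = [set: M].
  by have : [set z | S z = S q] p by rewrite E.
apply: conn; first by exists q.
  by exists [set z | S z = S q]; rewrite ?setTI.
exists [set z | S z = S q]; rewrite ?setTI //.
by rewrite -[[set z | _]]setCK; exact: open_closedC.
Qed.

End Charts.

Theorem mainTheorem10 (R : realType) (n : nat) (n_ge3 : (3 <= n)%N)
    (M : manifold R n) (M_connected : connected [set: M])
    (g : tensor2 M) (u : M -> R) (Y : tensor2 M) (xi : vector_field M)
    (lambda : R)
    (structure : einstein_CKY_RS_structure g u Y xi lambda)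
    (dphi_neq0 : nonzero_differential (fun p : M => expR (- u p))) :
  let phi := fun p : M => expR (- u p) in
  exists c : R,
    [/\ forall a x, chart_im a x -> c = lambda - lie_function xi u a x,
        forall a x, chart_im a x ->
          ricci (conformal_metric u g a) x = c *: conformal_metric u g a x,
        forall a x, chart_im a x ->
          lie_function xi phi a x = (c - lambda) * phi (param a x)
      & (forall a x, chart_im a x -> lie_function xi phi a x = 0) \/ c = 0].
Proof.
move=> phi; have [[gpr us [Ya cky] assoc soliton] [L einst]] := structure.
have n3 : n = (n - 3).+3 by rewrite -addn3 subnK.
have local a := einstein_cky_rs_chart (@chart_im_open _ _ M a) n3 (tcomp_smooth g a)
  (tcomp_smooth Y a) (vcomp_smooth xi a) (us a) (gpr a) (Ya a) (cky a) (assoc a)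
  (einst a) (soliton a).
have /choice[ch chP] : forall p : M, exists a, chart_dom a p := @chart_cover _ _ M.
(* xi(u) as a function on M: a chart is chosen at each point, and [lie_function_transition] makes
   the value independent of the choice. *)
pose S p := lie_function xi u (ch p) (Defs.coord (ch p) p).
have SE a p : chart_dom a p -> S p = lie_function xi u a (Defs.coord a p).
  by move=> ap; exact: lie_function_transition.
have locS p : \forall q \near p, S q = S p.
  have ap := chP p; set a := ch p in ap.
  have [_ C1 pd0 _] := local a.
  have [r r0 rP] := zero_pd_locally_constant (@chart_im_open _ _ M a) (chart_im_coord ap)
    C1 pd0.
  have n1 : \forall q \near p, chart_dom a q.
    by apply: open_nbhs_nbhs; split; [exact: chart_dom_open | exact: ap].
  have n2 : \forall q \near p, `|Defs.coord a q - Defs.coord a p| < r.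
    have /cvgrPdist_lt/(_ r r0) := Defs.coord_continuous ap.
    by apply: filterS => q; rewrite distrC.
  apply: filterS2 n1 n2 => q aq qr.
  by rewrite (SE a q aq) (SE a p ap); exact: rP.
(* The point where dphi is nonzero serves as base point, at which the constant value of xi(u) is
   read. *)
have [a0 [x0 [_ [ax0 _]]]] := dphi_neq0.
pose p0 := param a0 x0.
have sE a x : chart_im a x -> lie_function xi u a x = S p0.
  move=> ax; have [ap <-] := chart_im_param ax.
  by rewrite -(SE a _ ap); exact: locally_constant_connected.
have phiE a x : chart_im a x ->
    lie_function xi phi a x = - S p0 * phi (param a x).
  move=> ax; rewrite -(sE a x ax) /lie_function /lie_scalar mulNr mulr_suml -sumrN.
  apply: eq_bigr => i _; rewrite -mulrA -mulrN; congr (_ * _).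
  have du := CkS_is_derive i (us a 1%N) ax.
  have [_ E] := is_derive_exp (is_deriveN du); apply: etrans E _.
  by rewrite mulrN mulrC.
exists (lambda - S p0); split.
- by move=> a x ax; rewrite sE.
- by move=> a x ax; rewrite -(sE a x ax); have [+ _ _ _] := local a; apply.
- by move=> a x ax; rewrite phiE // addrAC subrr add0r.
(* At the base point c s = 0 is an equation between real numbers, so a factor vanishes; constancy
   carries s = 0 to all charts. *)
- have [_ _ _ /(_ x0 ax0)/eqP] := local a0.
  rewrite mulf_eq0 => /orP[/eqP c0|/eqP sp0]; [right | left].
    by rewrite -(sE a0 x0 ax0).
  by move=> a x ax; rewrite phiE // -(sE a0 x0 ax0) /lie_function sp0 oppr0 mul0r.
Qed.
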